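(* For any $\mathscr{B}\subseteq\mathbb{N}$ such that $\eta^*$ is a regular Toeplitz sequence, we have $$h(X_\eta)=0\iff\mathcal{P}(X_\eta)=\{\nu_\eta\}\iff X_\eta\text{ is uniquely ergodic}$$ (and if these conditions hold then $\nu_\eta=\nu_{\eta^*}$).
   Context: $\mathbb{N}=\{1,2,\dots\}$. For $\mathscr{A}\subseteq\mathbb{N}$: $\mathcal{M}_{\mathscr{A}}=\bigcup_{a\in\mathscr{A}}a\mathbb{Z}$, $\mathcal{F}_{\mathscr{A}}=\mathbb{Z}\setminus\mathcal{M}_{\mathscr{A}}$, and $\mathscr{A}^{prim}$ is the set of those $a\in\mathscr{A}$ not divisible by any other element of $\mathscr{A}$. $\mathscr{B}^*=(\mathscr{B}\cup D)^{prim}$, where $D=\{d\in\mathbb{N}: d\mathcal{A}\subseteq\mathscr{B}\text{ for some infinite pairwise coprime set }\mathcal{A}\subseteq\mathbb{N}\}$. Put $\eta=\mathbf{1}_{\mathcal{F}_{\mathscr{B}}}$, $\eta^*=\mathbf{1}_{\mathcal{F}_{\mathscr{B}^*}}$ in $\{0,1\}^{\mathbb{Z}}$. For $x\in\{0,1\}^{\mathbb{Z}}$, $X_x$ is the closure of $\{\sigma^kx:k\in\mathbb{Z}\}$, $\sigma$ being the left shift. For a subshift $X$, $\mathcal{P}(X)$ is the set of $\sigma$-invariant Borel probability measures on $X$; $X$ is uniquely ergodic if $\mathcal{P}(X)$ is a singleton. The topological entropy is $h(X)=\lim_{n\to\infty}\frac1n\log_2p_n(X)$, where $p_n(X)$ is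 the number of distinct blocks of length $n$ appearing in elements of $X$. The Mirsky measure $\nu_\eta$ is the weak limit of $\frac1{\ell_i}\sum_{1\le\ell\le\ell_i}\delta_{\sigma^\ell\eta}$ along any sequence $\ell_i\to\infty$ realizing the lower density of $\mathcal{M}_{\mathscr{B}}$, i.e. with $\lim_i\frac1{\ell_i}|\mathcal{M}_{\mathscr{B}}\cap[1,\ell_i]|=\liminf_{L\to\infty}\frac1L|\mathcal{M}_{\mathscr{B}}\cap[1,L]|$ (the limit is known to exist and not to depend on the sequence); $\nu_{\eta^*}$ is defined in the same way from $\mathscr{B}^*$. A sequence $x\in\{0,1\}^{\mathbb{Z}}$ is Toeplitz if for each $i\in\mathbb{Z}$ there is $s\in\mathbb{N}$ with $x(i+sk)=x(i)$ for all $k\in\mathbb{Z}$. Let $\mathrm{Per}(x,s)=\{i\in\mathbb{Z}: x(i+sk)=x(i)\text{ for all }k\in\mathbb{Z}\}$. A Toeplitz sequence $x$ is regular if $\lim_{r\to\infty}d\big(\bigcup_{s\le r}\mathrm{Per}(x,s)\big)=1$, where $d(A)=\lim_{L\to\infty}\frac1L|A\cap[1,L]|$. (The sequence $\eta^*$ is always Toeplitz.) *)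

(* Defs.v *)
From HB Require Import structures.
From mathcomp Require Import all_boot all_order all_algebra.
From mathcomp Require Import all_classical all_reals all_analysis.

Set Implicit Arguments.
Unset Strict Implicit.
Unset Printing Implicit Defensive.

Import Order.TTheory GRing.Theory Num.Theory.
Import numFieldNormedType.Exports.

Local Open Scope classical_set_scope.
Local Open Scope ring_scope.

(* Subsets of {1, 2, ...} are given as A : set nat together with the
   hypothesis [pos_set A]. *)
Definition pos_set (A : set nat) : Prop := forall a, A a -> (0 < a)%N.

Definition multiples (A : set nat) : set int :=
  \bigcup_(a in A) range (fun k : int => a%:Z * k).

Definition free_set (A : set nat) : set int := ~` multiples A.

Definition prim (A : set nat) : set nat :=
  [set a | A a /\ forall a', A a' -> (a' %| a)%N -> a' = a].

Definition pairwise_coprime (A : set nat) : Prop :=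
  forall a b, A a -> A b -> a <> b -> coprime a b.

Definition D_set (B : set nat) : set nat :=
  [set d | (0 < d)%N /\ exists A : set nat,
    [/\ pos_set A, infinite_set A, pairwise_coprime A &
        forall a, A a -> B (d * a)%N]].

Definition Bstar (B : set nat) : set nat := prim (B `|` D_set B).

(* {0,1}^Z with the product of the discrete topologies. *)
Definition conf := {ptws int -> bool}.

(* The same type {0,1}^Z, equipped with its Borel sigma-algebra. *)
Definition bconf := g_sigma_algebraType (@open conf).

(* [sigma k] is the k-th power of the left shift. *)
Definition sigma (k : int) (x : conf) : conf := fun i => x (i + k).

(* Characteristic function of the B-free integers. *)
Definition free_char (B : set nat) : conf := fun z => z \in free_set B.

Definition orbit_closure (x : conf) : set conf :=
  closure (range (fun k : int => sigma k x)).

Definition appears (X : set conf) (n : nat) (w : {ffun 'I_n -> bool}) : Prop :=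
  exists x : conf, X x /\
    exists i : int, forall j : 'I_n, w j = x (i + (j : nat)%:Z).

Definition complexity (X : set conf) (n : nat) : nat :=
  #|[set w : {ffun 'I_n -> bool} | `[< appears X w >]]%SET|.

Definition log2 (R : realType) (t : R) : R := ln t / ln 2.

(* The limit exists for every nonempty subshift X, by subadditivity. *)
Definition entropy (R : realType) (X : set conf) : R :=
  limn (fun n : nat => log2 (complexity X n)%:R / n%:R : R).

(* P(X), for X a subshift. A Borel probability measure on X is represented by
   a Borel probability measure on {0,1}^Z giving mass 1 to the closed set X. *)
Definition inv_probs (R : realType) (X : set conf) : set (probability bconf R) :=
  [set mu | mu (X : set bconf) = 1%E /\
    forall A : set bconf, measurable A -> mu (sigma 1 @^-1` A) = mu A].
Arguments inv_probs : clear implicits.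

(* The library's measures are functions on all subsets, with unconstrained
   values on the non-measurable ones; equality of Borel measures is thus
   agreement on the Borel sets. *)
Definition same_measure (R : realType) (mu nu : probability bconf R) : Prop :=
  forall A : set bconf, measurable A -> mu A = nu A.

(* The singleton {nu}, up to equality of Borel measures. *)
Definition msingleton (R : realType) (nu : probability bconf R) :
    set (probability bconf R) :=
  [set mu | same_measure mu nu].

Definition uniquely_ergodic (R : realType) (X : set conf) : Prop :=
  exists mu : probability bconf R, inv_probs R X = msingleton mu.
Arguments uniquely_ergodic : clear implicits.

(* |A cap [1, L]| / L *)
Definition freq (R : realType) (A : set int) (L : nat) : R :=
  (\sum_(1 <= l < L.+1) ((l%:Z \in A) : nat))%N%:R / L%:R.
Arguments freq : clear implicits.

Definition lower_density (R : realType) (A : set int) : R :=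
  limn_inf (freq R A).
Arguments lower_density : clear implicits.

Definition density (R : realType) (A : set int) : R := limn (freq R A).
Arguments density : clear implicits.

(* (1 / L) sum_{1 <= l <= L} delta_(sigma^l x); the zero measure for L = 0. *)
Definition empirical (R : realType) (x : conf) (L : nat) :
    {measure set bconf -> \bar R} :=
  mscale (L%:R^-1)%:nng
    (msum (fun l : nat => \d_(sigma l.+1%:Z x : bconf)) L).
Arguments empirical : clear implicits.

(* {0,1}^Z is compact, so that continuous functions are bounded. *)
Definition weak_cvg (R : realType) (mu_ : nat -> {measure set bconf -> \bar R})
    (mu : {measure set bconf -> \bar R}) : Prop :=
  forall f : conf -> R, continuous f ->
    (\int[mu_ i]_x (f x)%:E)%E @[i --> \oo] --> (\int[mu]_x (f x)%:E)%E.

Definition realizes_lower_density (R : realType) (A : set int)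
    (l : nat -> nat) : Prop :=
  l @ \oo --> \oo /\ freq R A (l i) @[i --> \oo] --> lower_density R A.
Arguments realizes_lower_density : clear implicits.

(* nu is the Mirsky measure of B. This determines nu on the Borel sets, since
   sequences realizing the lower density exist. *)
Definition is_mirsky (R : realType) (B : set nat) (nu : probability bconf R) :
    Prop :=
  forall l : nat -> nat, realizes_lower_density R (multiples B) l ->
    weak_cvg (fun i => empirical R (free_char B) (l i)) nu.

Definition Per (x : conf) (s : nat) : set int :=
  [set i | forall k : int, x (i + s%:Z * k) = x i].

Definition toeplitz (x : conf) : Prop :=
  forall i : int, exists s : nat, (0 < s)%N /\
    forall k : int, x (i + s%:Z * k) = x i.

(* The union is periodic, hence has a density for every r. *)
Definition regular_toeplitz (R : realType) (x : conf) : Prop :=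
  toeplitz x /\
  density R (\bigcup_(s in [set s | (1 <= s <= r)%N]) Per x s) @[r --> \oo]
    --> (1 : R).
Arguments regular_toeplitz : clear implicits.

(* Main.v *)
Require Import Defs.
From HB Require Import structures.
From mathcomp Require Import all_boot all_order all_algebra.
From mathcomp Require Import all_classical all_reals all_analysis.
From mathcomp Require Import measurable_realfun.
From mathcomp Require Import zify ring lra.
Import Order.TTheory GRing.Theory Num.Theory.
Import numFieldNormedType.Exports.
Local Open Scope classical_set_scope.
Local Open Scope ring_scope.

Set Implicit Arguments.
Unset Strict Implicit.
Unset Printing Implicit Defensive.

(** Write eta and eta* for the characteristic functions of the [B]-free and of
the [Bstar B]-free integers; eta* lies below eta.  Everything is reduced to one
number, the density of the multiples of [B], measured by a finitely additive
shift-invariant mean [L] on sets of integers.  The mean has two further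
properties ([sieve_mean]): it dominates lower densities, and it is continuous
along sets of multiples, that is, the mean of [multiples A] is the supremum of
the means of the multiples of the finite truncations of [A].  The latter is a form
of the Davenport-Erdos theorem.  It is proved in [exists_sieve_mean] by taking
an ultralimit of the weights k |-> c k^(-1-alpha) on [1, K], which are, up to a
small loss of mass, the laws of a random divisor of a uniformly distributed integer
([sum_divisors_conv], [zeta_dominated]): a divisor lying in a set of multiples
forces the integer to lie in it.

The pivot of the proof is the inequality
[L (multiples (Bstar B)) <= L (multiples B)].

If it holds, regularity of eta* gives, for every e > 0, periodic sets
C included in F, with F minus C of density at most e, such that eta is 1 on C
and 0 off F ([mean_Bstar_nearly_periodic]): C is the part of the free set of
[Bstar B] lying in the first periods of eta*, and F is the free set of a finite
truncation of [B].  So eta is uniformly close to periodic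
configurations.  This bounds the number of its words, so that the entropy vanishes
([nearly_periodic_entropy0]), and makes the frequencies of words uniform, so that
invariant measures are unique ([nearly_periodic_unique]).

Unique ergodicity implies the inequality.  By the Chinese remainder theorem every
word of eta* occurs in eta ([window_Bstar]), so that both Mirsky measures live on
the orbit closure of eta and coincide; comparing their values on the cylinder
x(0) = 1 shows that the lower densities of [multiples B] and
[multiples (Bstar B)] agree ([mirsky_one_at0], [lower_density_mean_Bstar]).

Zero entropy implies the inequality.  If it fails, then for some d in [D_set B]
the free multiples of d have positive mean.  Along a progression of difference d
one can then put zeros on any prescribed set S of n positions, using multiples of
d a with a running through pairwise coprime numbers, while a fixed proportion of
the other positions stays free ([window_avoiding_many]); the conditioning does not
thin out the free positions because only the elements of [B] prime to the moduli
a can still act on them ([mean_sieved_class]).  Hence the number of words grows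
exponentially ([disjoint_family_card], [mean_free_D_pos]). *)

(** * A partition of unity over the divisors *)

Section DivisorWeights.
Variables (R : realType) (f : nat -> R).
Hypothesis f1 : f 1%N = 1.
Hypothesis fM : forall m n, (0 < m)%N -> (0 < n)%N -> f (m * n)%N = f m * f n.

(** The function g whose Dirichlet convolution with [f] is the constant 1, for [f]
completely multiplicative. *)
Definition conv_compl (n : nat) : R := \prod_(p <- primes n) (1 - f p).

Lemma conv_compl_prime p n : prime p -> (0 < n)%N -> (p %| n)%N ->
  conv_compl n = (1 - f p) * conv_compl n`_(negn p).
Proof.
move=> pp n0 pn; rewrite /conv_compl.
rewrite (perm_big (p :: primes n`_(negn p))) ?big_cons //.
apply: uniq_perm; rewrite ?primes_uniq //= ?primes_uniq ?andbT.
  by rewrite mem_primes !negb_and -p'natE // part_pnat ?orbT.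
move=> q; rewrite inE primes_part mem_filter !inE /=.
by case: eqVneq => //= ->; rewrite mem_primes pp n0.
Qed.

Lemma divisors_coprime_part p n : prime p -> (0 < n)%N ->
  perm_eq [seq k <- divisors n | ~~ (p %| k)%N] (divisors n`_(negn p)).
Proof.
move=> pp n0; apply: uniq_perm; rewrite ?filter_uniq ?divisors_uniq // => k.
rewrite mem_filter -!dvdn_divisors ?part_gt0 //; apply/andP/idP => [[pk kn]|kn].
  have k0 : (0 < k)%N by rewrite (dvdn_gt0 n0).
  have kp : (negn p).-nat k by rewrite p'natE.
  by rewrite -(part_pnat_id kp) partn_dvd.
split; last exact: dvdn_trans kn (dvdn_part _ _).
rewrite -p'natE //; exact: pnat_dvd kn (part_pnat _ _).
Qed.

Lemma divisors_multiple p n : prime p -> (0 < n)%N -> (p %| n)%N ->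
  perm_eq [seq k <- divisors n | (p %| k)%N] (map (muln p) (divisors (n %/ p))).
Proof.
move=> pp n0 pn; have p0 := prime_gt0 pp.
have np0 : (0 < n %/ p)%N by rewrite divn_gt0 // dvdn_leq.
apply: uniq_perm; rewrite ?filter_uniq ?divisors_uniq //.
  rewrite map_inj_uniq ?divisors_uniq // => i j /eqP; rewrite eqn_pmul2l //.
  by move/eqP.
move=> k; rewrite mem_filter -dvdn_divisors //; apply/andP/mapP => [[pk kn]|].
  exists (k %/ p)%N; last by rewrite mulnC divnK.
  by rewrite -dvdn_divisors // -(@dvdn_pmul2l p) // mulnC divnK // mulnC divnK.
move=> [j]; rewrite -dvdn_divisors // => jn ->; split; first exact: dvdn_mulr.
by rewrite -[X in (_ %| X)%N](divnK pn) mulnC dvdn_pmul2r.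
Qed.

(** Let p be a prime divisor of n.  By induction, the divisors of n that are
multiples of p contribute [f p] and the others contribute [1 - f p]. *)
Lemma sum_divisors_conv n : (0 < n)%N ->
  \sum_(k <- divisors n) f k * conv_compl (n %/ k) = 1.
Proof.
elim/ltn_ind: n => n IH n0.
have [n1|n1] := leqP n 1%N.
  have -> : n = 1%N by apply/eqP; rewrite eqn_leq n1.
  have -> : divisors 1 = [:: 1%N] by [].
  by rewrite big_seq1 f1 divn1 mul1r /conv_compl big_nil.
set p := pdiv n; have pp : prime p by exact: pdiv_prime.
have pn : (p %| n)%N by exact: pdiv_dvd.
have p0 := prime_gt0 pp; have p1 := prime_gt1 pp.
have np0 : (0 < n %/ p)%N by rewrite divn_gt0 // dvdn_leq.
rewrite (bigID (fun k => p %| k)%N) /= -[X in X + _]big_filter -[X in _ + X]big_filter.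
rewrite (perm_big _ (divisors_multiple pp n0 pn)) big_map.
rewrite (perm_big _ (divisors_coprime_part pp n0)).
have -> : \sum_(j <- divisors (n %/ p)) f (p * j)%N * conv_compl (n %/ (p * j))
    = f p.
  rewrite big_seq (eq_bigr (fun j => f p * (f j * conv_compl (n %/ p %/ j)))).
    by rewrite -big_seq -mulr_sumr IH ?mulr1 // ltn_Pdiv.
  move=> j jd; rewrite divnMA mulrA fM //.
  by rewrite -dvdn_divisors // in jd; apply: dvdn_gt0 jd.
have m0 : (0 < n`_(negn p))%N by exact: part_gt0.
rewrite big_seq (eq_bigr (fun j => (1 - f p) * (f j * conv_compl (n`_(negn p) %/ j)))).
  rewrite -big_seq -mulr_sumr IH ?mulr1 //; first by rewrite addrC subrK.
  rewrite -[X in (_ < X)%N](partnC p n0) ltn_Pmull //.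
  by rewrite p_part -{1}(expn0 p) ltn_exp2l // logn_gt0 mem_primes pp n0.
move=> j; rewrite -dvdn_divisors // => jm.
have j0 : (0 < j)%N by apply: dvdn_gt0 jm.
have jn : (j %| n)%N by exact: dvdn_trans jm (dvdn_part _ _).
have pj : ~~ (p %| j)%N.
  by rewrite -p'natE //; exact: pnat_dvd jm (part_pnat _ _).
have nj0 : (0 < n %/ j)%N by rewrite divn_gt0 // dvdn_leq.
have pnj : (p %| n %/ j)%N.
  have : (p %| (n %/ j) * j)%N by rewrite divnK.
  by rewrite Euclid_dvdM // (negbTE pj) orbF.
rewrite (conv_compl_prime pp nj0 pnj) mulrCA; congr (_ * (_ * conv_compl _)).
have : (n`_(negn p) = (n %/ j)`_(negn p) * j)%N.
  rewrite -{1}(divnK jn) partnM //; congr (_ * _)%N.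
  by rewrite part_pnat_id // p'natE.
by move=> ->; rewrite mulnK.
Qed.

End DivisorWeights.

(** * Zeta weights dominated by densities *)

Lemma eqle (R : realType) (x y : R) : x = y -> x <= y.
Proof. by move=> ->. Qed.

Section PeriodicSums.
Variable R : realType.

Lemma sum_periodic_mul (Q m : nat) (g : nat -> R) :
  (forall j, g (j + Q)%N = g j) ->
  \sum_(1 <= j < (Q * m).+1) g j = m%:R * \sum_(1 <= j < Q.+1) g j.
Proof.
move=> gQ; have gQm i j : g (j + Q * i)%N = g j.
  by elim: i => [|i IH]; rewrite ?muln0 ?addn0 // mulnS addnCA addnC gQ.
elim: m => [|m IH]; first by rewrite muln0 big_geq // mul0r.
rewrite mulnS addnC (big_cat_nat (n := (Q * m).+1)) //= ?IH ?ltnS ?leq_addr //.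
rewrite -[X in _ = X%:R * _]addn1 natrD mulrDl mul1r; congr (_ + _).
rewrite -[(Q * m).+1]add1n big_addn.
have -> : ((Q * m + Q).+1 - Q * m = Q.+1)%N by lia.
apply: eq_bigr => j _.
by rewrite gQm.
Qed.

Lemma sum_multiples (k N : nat) (phi : nat -> R) : (0 < k)%N ->
  \sum_(1 <= n < N.+1 | (k %| n)%N) phi (n %/ k)%N =
  \sum_(1 <= j < (N %/ k).+1) phi j.
Proof.
move=> k0; elim: N => [|N IH]; first by rewrite div0n !big_geq.
rewrite big_mkcond big_nat_recr //= -big_mkcond /= IH divnS //.
case: ifP => kN /=; last by rewrite addr0.
by rewrite add1n [in RHS]big_nat_recr //= kN add1n.
Qed.

Lemma sum_divisors_range (N n : nat) (F : nat -> R) : (0 < n <= N)%N ->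
  \sum_(k <- divisors n) F k = \sum_(1 <= k < N.+1 | (k %| n)%N) F k.
Proof.
case/andP=> n0 nN; rewrite -[RHS]big_filter; apply: perm_big; apply: uniq_perm.
- exact: divisors_uniq.
- by rewrite filter_uniq // iota_uniq.
move=> k; rewrite mem_filter mem_index_iota -dvdn_divisors //.
case kn: (k %| n)%N => //=; rewrite ltnS (dvdn_gt0 n0 kn).
by rewrite (leq_trans (dvdn_leq n0 kn) nN).
Qed.

Lemma sum_divisors_swap (N : nat) (F g : nat -> R) :
  \sum_(1 <= n < N.+1) \sum_(k <- divisors n) F k * g (n %/ k)%N =
  \sum_(1 <= k < N.+1) F k * \sum_(1 <= j < (N %/ k).+1) g j.
Proof.
have -> : \sum_(1 <= n < N.+1) \sum_(k <- divisors n) F k * g (n %/ k)%N =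
    \sum_(1 <= n < N.+1) \sum_(1 <= k < N.+1)
      (if (k %| n)%N then F k * g (n %/ k)%N else 0).
  apply: eq_big_nat => n /andP[n0 nN].
  by rewrite (@sum_divisors_range N) ?n0 // big_mkcond.
rewrite exchange_big /=; apply: eq_big_nat => k /andP[k0 _].
rewrite -big_mkcond /= -sum_multiples // mulr_sumr.
by apply: eq_bigr.
Qed.

End PeriodicSums.

Section ZetaWeights.
Variables (R : realType) (alpha : R).
Hypothesis alpha0 : 0 < alpha.

(** k^(-alpha). *)
Definition npow (k : nat) : R := expR (- (alpha * ln k%:R)).

Lemma npow1 : npow 1 = 1.
Proof. by rewrite /npow ln1 mulr0 oppr0 expR0. Qed.

Lemma npow_gt0 k : 0 < npow k. Proof. exact: expR_gt0. Qed.

Lemma npowM m n : (0 < m)%N -> (0 < n)%N ->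
  npow (m * n) = npow m * npow n.
Proof.
move=> m0 n0; rewrite /npow natrM lnM ?posrE ?ltr0n //.
by rewrite mulrDr opprD expRD.
Qed.

Lemma npow_le m n : (0 < m)%N -> (m <= n)%N -> npow n <= npow m.
Proof.
move=> m0 mn; rewrite /npow ler_expR lerN2 ler_pM2l //.
by rewrite ler_ln ?posrE ?ltr0n ?ler_nat // (leq_trans m0 mn).
Qed.

Lemma npow_le1 k : npow k <= 1.
Proof.
case: k => [|k]; last by rewrite -npow1 npow_le.
by rewrite /npow (ln0 (lexx 0)) mulr0 oppr0 expR0.
Qed.

Lemma npow_diff k : (0 < k)%N ->
  alpha * (npow k.+1 / k.+1%:R) <= npow k - npow k.+1.
Proof.
move=> k0; have k1 : 0 < k.+1%:R :> R by rewrite ltr0n.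
have kR : 0 < k%:R :> R by rewrite ltr0n.
have E : npow k = npow k.+1 * expR (alpha * (ln k.+1%:R - ln k%:R)).
  by rewrite /npow -expRD; congr expR; rewrite mulrBr; lra.
have L : (k.+1%:R)^-1 <= ln k.+1%:R - ln k%:R :> R.
  have := @le_ln1Dx R (- (k.+1%:R)^-1).
  have -> : 1 - (k.+1%:R)^-1 = k%:R / k.+1%:R :> R.
    apply: (mulIf (lt0r_neq0 k1)); rewrite mulrBl mul1r mulVf ?lt0r_neq0 //.
    by rewrite mulfVK ?lt0r_neq0 // -natr1 addrK.
  rewrite ltrN2 invf_lt1 // ltr1n ltnS k0 => /(_ isT).
  by rewrite ln_div ?posrE // lerNr opprB.
have G : 1 + alpha * (k.+1%:R)^-1 <= expR (alpha * (ln k.+1%:R - ln k%:R)).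
  apply: le_trans (expR_ge1Dx _); rewrite lerD2l ler_pM2l //.
rewrite E lerBrDr.
have -> : alpha * (npow k.+1 / k.+1%:R) + npow k.+1 =
   npow k.+1 * (1 + alpha * (k.+1%:R)^-1) by rewrite mulrDr mulr1 addrC mulrCA.
by rewrite ler_pM2l // npow_gt0.
Qed.

(** Comparison with the telescoping sum given by [npow_diff]. *)
Lemma npow_tail K N : (0 < K)%N ->
  \sum_(K.+1 <= k < N.+1) npow k / k%:R <= npow K / alpha.
Proof.
move=> K0; rewrite ler_pdivlMr // mulrC mulr_sumr.
have [NK|KN] := ltnP N K.
  by rewrite big_geq ?ltnS ?(ltnW NK) // ltW ?npow_gt0.
rewrite big_add1 /=.
apply: le_trans (_ : \sum_(K <= i < N) (npow i - npow i.+1) <= _).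
  rewrite big_nat_cond [leRHS]big_nat_cond; apply: ler_sum => k.
  by rewrite andbT => /andP[Kk _]; apply: npow_diff; apply: leq_trans Kk.
rewrite -[leLHS]opprK -sumrN (eq_bigr (fun i => npow i.+1 - npow i)).
  by rewrite telescope_sumr // opprB gerBl ltW ?npow_gt0.
by move=> i _; rewrite opprB.
Qed.

Lemma npow_small e : 0 < e -> exists K0, forall K, (K0 <= K)%N ->
  npow K <= e.
Proof.
move=> e0; pose x := expR (- ln e / alpha).
have x0 : 0 < x by exact: expR_gt0.
exists (Num.truncn x).+1 => K KK.
have xK : x < K%:R.
  by apply: lt_le_trans (truncnS_gt x) _; rewrite ler_nat.
rewrite -[e]lnK ?posrE // /npow ler_expR lerNl.
rewrite -ler_pdivrMl // mulrC -[leLHS]expRK ler_ln ?posrE ?expR_gt0 //.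
  exact: ltW.
exact: lt_trans x0 xK.
Qed.

(** The restriction to K-smooth integers makes the convolution complement of this
completely multiplicative function periodic, with period K!. *)
Definition smooth_npow (K k : nat) : R :=
  if all (fun p => p <= K)%N (primes k) then npow k else 0.

Lemma smooth_npow1 K : smooth_npow K 1 = 1.
Proof. by rewrite /smooth_npow /= npow1. Qed.

Lemma smooth_npowM K m n : (0 < m)%N -> (0 < n)%N ->
  smooth_npow K (m * n) = smooth_npow K m * smooth_npow K n.
Proof.
move=> m0 n0; rewrite /smooth_npow npowM //.
have -> : all (fun p => p <= K)%N (primes (m * n)) =
  all (fun p => p <= K)%N (primes m) && all (fun p => p <= K)%N (primes n).
  rewrite -all_cat; apply: eq_all_r => p.
  by rewrite mem_cat primesM.
by case: all; case: all; rewrite ?mul0r ?mulr0.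
Qed.

Lemma smooth_npow_small K k : (0 < k <= K)%N -> smooth_npow K k = npow k.
Proof.
case/andP=> k0 kK; rewrite /smooth_npow; case: allP => // -[] p.
by rewrite mem_primes => /and3P[_ _ /(dvdn_leq k0)] pk; apply: leq_trans pk kK.
Qed.

Lemma smooth_npow_ge0 K k : 0 <= smooth_npow K k.
Proof. by rewrite /smooth_npow; case: ifP => // _; rewrite ltW ?npow_gt0. Qed.

Lemma smooth_npow_le K k : smooth_npow K k <= npow k.
Proof. by rewrite /smooth_npow; case: ifP => // _; rewrite ltW ?npow_gt0. Qed.

Lemma smooth_npow_prime_large K p : prime p -> (K < p)%N ->
  smooth_npow K p = 0.
Proof. by move=> pp Kp; rewrite /smooth_npow primes_prime //= leqNgt Kp. Qed.

Let g (K j : nat) : R :=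
  \prod_(1 <= p < K.+1 | prime p && (p %| j)%N) (1 - smooth_npow K p).

Let gE K j : (0 < j)%N -> g K j = conv_compl (smooth_npow K) j.
Proof.
move=> j0; rewrite /conv_compl (bigID (fun p => p <= K)%N) /=.
rewrite [X in _ = _ * X]big_seq_cond [X in _ = _ * X]big1 ?mulr1; last first.
  move=> p; rewrite mem_primes -ltnNge => /andP[/and3P[pp _ _] Kp].
  by rewrite smooth_npow_prime_large // subr0.
rewrite /g -big_filter -[in RHS]big_filter; apply: perm_big; apply: uniq_perm.
- by rewrite filter_uniq // iota_uniq.
- by rewrite filter_uniq // primes_uniq.
move=> p; rewrite !mem_filter mem_index_iota mem_primes j0 /= ltnS.
by case pp: (prime p); rewrite ?andbF //= prime_gt0 //= andbC.
Qed.

Let g01 K j : 0 <= g K j <= 1.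
Proof.
apply/andP; split.
  apply: prodr_ge0 => p _; rewrite subr_ge0.
  exact: le_trans (smooth_npow_le _ _) (npow_le1 _).
apply: prodr_ile1 => p _; rewrite gerBl smooth_npow_ge0 subr_ge0.
by rewrite (le_trans (smooth_npow_le _ _) (npow_le1 _)).
Qed.

Let g_periodic K j : g K (j + K`!) = g K j.
Proof.
rewrite /g [LHS]big_nat_cond [RHS]big_nat_cond; apply: eq_bigl => p.
case pK: (0 < p < K.+1)%N => //=; congr (_ && _).
by rewrite dvdn_addl // dvdn_fact.
Qed.

Let conv1 K n : (0 < n)%N ->
  \sum_(k <- divisors n) smooth_npow K k * g K (n %/ k)%N = 1.
Proof.
move=> n0.
rewrite -(sum_divisors_conv (smooth_npow1 K) (@smooth_npowM K) n0).
rewrite !big_seq; apply: eq_bigr => k; rewrite -dvdn_divisors // => kn.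
by rewrite gE // divn_gt0 ?(dvdn_gt0 n0 kn) // dvdn_leq.
Qed.

(** The mean of the convolution complement over a period; it is the Euler product
of the factors 1 - p^(-1-alpha) over the primes p <= K. *)
Definition zeta_const (K : nat) : R :=
  (\sum_(1 <= j < K`!.+1) g K j) / K`!%:R.

Lemma zeta_const_ge0 K : 0 <= zeta_const K.
Proof.
apply: mulr_ge0; last by rewrite invr_ge0 ler0n.
by apply: sumr_ge0 => j _; case/andP: (g01 K j).
Qed.

Let sum_g K m : (K`! %| m)%N ->
  \sum_(1 <= j < m.+1) g K j = m%:R * zeta_const K.
Proof.
move=> /dvdnP[c ->]; rewrite mulnC sum_periodic_mul; last exact: g_periodic.
rewrite natrM /zeta_const [K`!%:R * _]mulrC -mulrA; congr (_ * _).
by rewrite mulrCA divff ?mulr1 // pnatr_eq0 -lt0n fact_gt0.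
Qed.

Let N T K := (T * (K`! * K`!))%N.

Let sum_g_div T K k : (0 < T)%N -> (0 < k <= K)%N ->
  \sum_(1 <= j < (N T K %/ k).+1) g K j = (N T K)%:R * (zeta_const K / k%:R).
Proof.
move=> T0 /andP[k0 kK].
have kf : (k %| K`!)%N by rewrite dvdn_fact // k0.
have kN : (k %| N T K)%N by rewrite /N !dvdn_mull.
rewrite sum_g; last first.
  by rewrite /N mulnCA -muln_divA; [exact: dvdn_mulr | exact: dvdn_mull].
rewrite -[in RHS](divnK kN) natrM -mulrA; congr (_ * _).
by rewrite mulrCA divff ?mulr1 // pnatr_eq0 -lt0n.
Qed.

(** By [sum_divisors_conv] each n carries a probability on its divisors; if a
divisor satisfies the hereditary condition M then so does n.  Averaging over
1 <= n <= N, with N a multiple of all the periods in play, a divisor k <= K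
receives exactly the mass [zeta_const K * npow k / k]. *)
Lemma zeta_dominated (K T : nat) (M : nat -> bool) : (0 < T)%N ->
  (forall k n, (k %| n)%N -> M k -> M n) ->
  (forall n, M (n + T)%N = M n) ->
  T%:R * \sum_(1 <= k < K.+1) zeta_const K * (npow k / k%:R) * (M k)%:R <=
  \sum_(1 <= n < T.+1) (M n)%:R :> R.
Proof.
move=> T0 Mup MT.
have N0 : (0 < N T K)%N by rewrite /N !muln_gt0 T0 fact_gt0.
have c0 : 0 < (K`! * K`!)%:R :> R by rewrite ltr0n muln_gt0 fact_gt0.
rewrite -(ler_pM2l c0) mulrA -natrM mulnC.
rewrite -(@sum_periodic_mul R T _ (fun n => (M n)%:R)); last first.
  by move=> j; rewrite MT.
rewrite -/(N T K).
apply: le_trans (_ : \sum_(1 <= n < (N T K).+1) \sum_(k <- divisors n)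
    (smooth_npow K k * (M k)%:R) * g K (n %/ k)%N <= _); last first.
  rewrite big_nat_cond [leRHS]big_nat_cond; apply: ler_sum => n.
  rewrite andbT => /andP[n0 _].
  have [Mn|Mn] := boolP (M n).
    rewrite -[leRHS](conv1 K n0); apply: ler_sum => k _.
    apply: ler_wpM2r; first by case/andP: (g01 K (n %/ k)).
    by rewrite -[leRHS]mulr1 ler_wpM2l ?smooth_npow_ge0 // lern1 leq_b1.
  rewrite big_seq big1 // => k; rewrite -dvdn_divisors // => kn.
  case Mk: (M k); last by rewrite mulr0n mulr0 mul0r.
  by rewrite (Mup _ _ kn Mk) in Mn.
rewrite sum_divisors_swap.
have KN : (K <= N T K)%N.
  have [->//|K0] := posnP K; apply: dvdn_leq => //.
  by rewrite /N dvdn_mull // dvdn_mulr // dvdn_fact // K0 /=.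
rewrite [leRHS](big_cat_nat (n := K.+1)) //= -[leLHS]addr0 lerD //; last first.
  apply: sumr_ge0 => k _; rewrite mulr_ge0 //.
    by rewrite mulr_ge0 ?smooth_npow_ge0.
  by apply: sumr_ge0 => j _; case/andP: (g01 K j).
rewrite [leLHS]mulr_sumr [leLHS]big_nat_cond [leRHS]big_nat_cond.
apply: ler_sum => k.
rewrite andbT ltnS => kK; rewrite sum_g_div // smooth_npow_small //.
by apply/eqle; case: (M k); rewrite !(mulr1, mulr0, mul0r) //; lra.
Qed.

Lemma zeta_total_le1 K :
  \sum_(1 <= k < K.+1) zeta_const K * (npow k / k%:R) <= 1.
Proof.
have := @zeta_dominated K 1 (fun=> true) isT (fun _ _ _ _ => isT) (fun=> erefl).
rewrite big_nat1 mul1r; apply: le_trans; apply/eqle/eq_bigr => k _.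
by rewrite mulr1.
Qed.

(** The divisor weights of every n add up to 1, and the divisors k > K receive
at most the tail of the zeta series. *)
Lemma zeta_total_ge K : (0 < K)%N ->
  1 - npow K / alpha <= \sum_(1 <= k < K.+1) zeta_const K * (npow k / k%:R).
Proof.
move=> K0; have N0 : (0 < N 1 K)%N by rewrite /N !muln_gt0 fact_gt0.
have NR : 0 < (N 1 K)%:R :> R by rewrite ltr0n.
have KN : (K <= N 1 K)%N.
  by apply: dvdn_leq => //; rewrite /N mul1n dvdn_mulr // dvdn_fact // K0 /=.
rewrite lerBlDr -(ler_pM2l NR) mulr1.
rewrite [leLHS](_ : _ = \sum_(1 <= n < (N 1 K).+1) \sum_(k <- divisors n)
    smooth_npow K k * g K (n %/ k)%N); last first.
  rewrite (eq_big_nat _ _ (F2 := fun=> 1)) => [|n /andP[n0 _]].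
    by rewrite big_const_nat subSS subn0 iter_addr addr0.
  by rewrite conv1.
rewrite sum_divisors_swap [leLHS](big_cat_nat (n := K.+1)) //= mulrDr.
apply: lerD.
  rewrite [leRHS]mulr_sumr [leLHS]big_nat_cond [leRHS]big_nat_cond.
  apply: ler_sum => k.
  rewrite andbT ltnS => kK; rewrite sum_g_div // smooth_npow_small //.
  by apply/eqle; ring.
apply: le_trans (ler_wpM2l (ltW NR) (npow_tail (N 1 K) K0)).
rewrite [leRHS]mulr_sumr [leLHS]big_nat_cond [leRHS]big_nat_cond.
apply: ler_sum => k.
rewrite andbT => /andP[Kk _]; have k0 : (0 < k)%N by apply: leq_trans Kk.
rewrite mulrCA; apply: ler_pM.
- exact: smooth_npow_ge0.
- by apply: sumr_ge0 => j _; case/andP: (g01 K j).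
- exact: smooth_npow_le.
apply: (@le_trans _ _ (N 1 K %/ k)%:R).
  rewrite [leRHS](_ : _ = \sum_(1 <= j < (N 1 K %/ k).+1) 1); last first.
    by rewrite big_const_nat subSS subn0 iter_addr addr0.
  by apply: ler_sum => j _; case/andP: (g01 K j).
by rewrite ler_pdivlMr ?ltr0n // -natrM ler_nat leq_trunc_div.
Qed.

End ZetaWeights.

(** * Slowly varying weights and lower density *)

Section SmoothWeights.
Variable R : realType.

(** Summation by parts. *)
Lemma abel_bound (u a : nat -> R) (m : R) (K : nat) :
  (forall k, 0 <= u k) -> (forall k, (0 < k)%N -> u k.+1 <= u k) ->
  (forall n, - m <= \sum_(1 <= k < n.+1) a k) ->
  - (m * u 1%N) <= \sum_(1 <= k < K.+1) u k * a k.
Proof.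
move=> u0 u_anti P.
have m0 : 0 <= m by have := P 0%N; rewrite big_geq // oppr_le0.
case: K => [|K]; first by rewrite big_geq // oppr_le0 mulr_ge0.
have H : - (m * (u 1%N - u K.+1)) <=
    \sum_(1 <= k < K.+2) u k * a k - u K.+1 * \sum_(1 <= k < K.+2) a k.
  elim: K => [|K IH]; first by rewrite !big_nat1 !subrr mulr0 oppr0.
  rewrite !(@big_nat_recr _ _ _ K.+2) //= mulrDr.
  have d0 : 0 <= u K.+1 - u K.+2 by rewrite subr_ge0 u_anti.
  have := ler_wpM2l d0 (P K.+1); move: IH.
  set S := \sum_(1 <= k < _) (_ * _); set Q := \sum_(1 <= k < _) _.
  by move=> *; nra.
have := ler_wpM2l (u0 K.+1) (P K.+1); move: H.
set S := \sum_(1 <= k < _) (_ * _); set Q := \sum_(1 <= k < _) _.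
by move=> *; nra.
Qed.

Lemma harmonic_unbounded (c : R) : exists N, c <= \sum_(1 <= k < N.+1) (k%:R)^-1.
Proof.
have nd : {homo series (@harmonic R) : n m / (n <= m)%N >-> n <= m}.
  by apply: nondecreasing_series => k _ _; rewrite /= invr_ge0.
have := nondecreasing_dvgn_lt nd (@dvg_harmonic R).
move=> /cvgryPge /(_ c) [N _ /(_ N (leqnn N))] h; exists N.
by move: h; rewrite /series /= big_add1.
Qed.

(** Zeta weights with alpha small enough for the zeta sum to exceed 1/e, which
makes every weight small, and then K large enough for the tail beyond K to be
negligible. *)
Lemma divisor_dominated_weights (e : R) : 0 < e ->
  exists (K : nat) (u : nat -> R),
    [/\ forall k, 0 <= u k,
        forall k, (0 < k)%N -> u k.+1 <= u k,
        u 1%N <= e,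
        1 - e <= \sum_(1 <= k < K.+1) u k <= 1 &
        forall (T : nat) (M : nat -> bool), (0 < T)%N ->
          (forall k n, (k %| n)%N -> M k -> M n) ->
          (forall n, M (n + T)%N = M n) ->
          T%:R * \sum_(1 <= k < K.+1) u k * (M k)%:R <=
            \sum_(1 <= n < T.+1) (M n)%:R].
Proof.
move=> e0; have [K1 HK1] := harmonic_unbounded (2 / e).
have ln2 : 0 < ln 2 :> R by rewrite ln_gt0 // ltr1n.
have lK : 0 <= ln K1.+1%:R :> R by rewrite ln_ge0 // ler1n.
(* this exponent keeps k^(-alpha) >= 1/2 up to K1 + 1 *)
pose al := ln 2 / (ln K1.+1%:R + 1) : R.
have al0 : 0 < al by rewrite divr_gt0 // ltr_wpDl.
have h2 : 2^-1 <= npow al K1.+1.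
  rewrite /npow -[leLHS]lnK ?posrE ?invr_gt0 // ler_expR lnV ?posrE // lerN2.
  rewrite /al mulrAC ler_pdivrMr ?ltr_wpDl //.
  by rewrite ler_pM2l // lerDl.
have [K2 HK2] := npow_small al0 (mulr_gt0 al0 e0).
pose K := (K1 + K2).+1.
exists K, (fun k => zeta_const al K * (npow al k / k%:R)).
have z0 := zeta_const_ge0 al0 K.
split.
- by move=> k; rewrite mulr_ge0 // mulr_ge0 ?invr_ge0 // ltW // npow_gt0.
- move=> k k0; rewrite ler_wpM2l //; apply: ler_pM.
  + by rewrite ltW // npow_gt0.
  + by rewrite invr_ge0.
  + exact: npow_le.
  + by rewrite lef_pV2 ?posrE ?ltr0n // ler_nat.
- rewrite npow1 divr1 mulr1.
  have S1 := zeta_total_le1 al0 K; rewrite -mulr_sumr in S1.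
  have S2 : e^-1 <= \sum_(1 <= k < K.+1) npow al k / k%:R.
    rewrite (big_cat_nat (n := K1.+1)) //=; last first.
      by rewrite /K !ltnS leqW // leq_addr.
    rewrite -[leLHS]addr0 lerD //; last first.
      by apply: sumr_ge0 => k _; rewrite mulr_ge0 ?invr_ge0 // ltW ?npow_gt0.
    apply: (@le_trans _ _ (\sum_(1 <= k < K1.+1) 2^-1 * (k%:R)^-1)).
      by rewrite -mulr_sumr ler_pdivlMl // -[X in X * _]invrK mulrC
        -ler_pdivlMl ?invr_gt0 // invrK mulrC.
    rewrite [leLHS]big_nat_cond [leRHS]big_nat_cond; apply: ler_sum => k.
    rewrite andbT ltnS => /andP[k0 kK]; rewrite ler_wpM2r ?invr_ge0 //.
    by apply: le_trans h2 _; apply: npow_le => //; exact: leqW.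
  rewrite -(invrK e) -[leRHS]div1r ler_pdivlMr ?invr_gt0 //.
  by apply: le_trans S1; rewrite ler_wpM2l.
- apply/andP; split; last exact: zeta_total_le1.
  apply: le_trans (zeta_total_ge al0 _) => //.
  rewrite lerD2l lerN2 ler_pdivrMr // mulrC; apply: HK2.
  by rewrite /K leqW // leq_addl.
- exact: zeta_dominated.
Qed.

End SmoothWeights.

Lemma freq01 (R : realType) (E : set int) L : 0 <= freq R E L <= 1.
Proof.
rewrite /freq divr_ge0 //=; case: L => [|L].
  by rewrite big_geq // mul0r.
rewrite ler_pdivrMr ?ltr0n // mul1r ler_nat.
rewrite -[leqRHS]subn0 -[leqRHS]muln1 -[(L.+1 - 0)%N]subSS -sum_nat_const_nat.
by apply: leq_sum => i _; case: (_ \in _).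
Qed.

Lemma freq_bounded (R : realType) (E : set int) : bounded_fun (freq R E : nat -> R^o).
Proof.
exists 1; split; first exact: num_real.
move=> x x1 n _ /=; have /andP[h0 h1] := freq01 R E n.
by rewrite ger0_norm // (le_trans h1) // ltW.
Qed.

Lemma lower_density_freq (R : realType) (E : set int) (e : R) : 0 < e ->
  exists L0, forall L, (L0 <= L)%N -> lower_density R E - e <= freq R E L.
Proof.
move=> e0; rewrite /lower_density limn_infE; last exact: freq_bounded.
have hs : has_sup (range (infs (freq R E : nat -> R^o))).
  split; first by exists (infs (freq R E : nat -> R^o) 0%N); exists 0%N.
  exact: bounded_fun_has_ubound_infs (@freq_bounded R E).
have [_ [n _ <-] hn] := sup_adherent e0 hs.
exists n => L nL; apply: le_trans (ltW hn) _.
apply: ge_inf; last by exists L.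
by exists 0 => _ [k _ <-]; case/andP: (freq01 R E k).
Qed.

Lemma lower_density_ge (R : realType) (E : set int) (c : R) L0 :
  (forall L, (L0 <= L)%N -> c <= freq R E L) -> c <= lower_density R E.
Proof.
move=> h; rewrite /lower_density limn_infE; last exact: freq_bounded.
apply: (@le_trans _ _ (infs (freq R E : nat -> R^o) L0)).
  apply: lb_le_inf; first by exists (freq R E L0); exists L0 => /=.
  by move=> _ [k /= Lk <-]; apply: h.
apply: ub_le_sup; last by exists L0.
exact: bounded_fun_has_ubound_infs (@freq_bounded R E).
Qed.

Lemma lower_density_realized (R : realType) (E : set int) :
  exists l, realizes_lower_density R E l.
Proof.
have freq_lt (n : nat) (e : R) : 0 < e ->
    exists L, (n <= L)%N /\ freq R E L < lower_density R E + e.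
  move=> e0; apply: contrapT => H.
  have : lower_density R E + e <= lower_density R E.
    apply: (@lower_density_ge _ _ _ n) => L nL; rewrite leNgt; apply/negP => h.
    by apply: H; exists L.
  by rewrite gerDl leNgt e0.
have /choice[l Hl] : forall n : nat, exists L, (n <= L)%N /\
    freq R E L < lower_density R E + n.+1%:R^-1.
  by move=> n; apply: freq_lt; rewrite invr_gt0.
exists l; split.
  by apply/cvgnyPge => A; near do rewrite (leq_trans _ (proj1 (Hl _))) //; exact: nbhs_infty_ge.
apply/cvgrPdist_le => e e0.
have [L0 HL0] := @lower_density_freq R E e e0.
near=> n; rewrite ler_norml; apply/andP; split.
  have := (Hl n).2; rewrite lerBrDr => /ltW h.
  rewrite addrC -lerBrDr opprK; apply: le_trans h _; rewrite lerD2l.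
  apply: ltW; near: n; exact: near_infty_natSinv_lt (PosNum e0).
have : lower_density R E - e <= freq R E (l n).
  by apply: HL0; apply: leq_trans (Hl n).1; near: n; exact: nbhs_infty_ge.
by rewrite lerBlDl lerBlDr.
Unshelve. all: by end_near.
Qed.

(** * Shift-invariant means *)

Definition periodic (T : nat) (E : set int) : Prop :=
  forall k : int, E (k + T%:Z) <-> E k.

Lemma periodic_mulz T E (k m : int) : periodic T E -> E (k + T%:Z * m) <-> E k.
Proof.
move=> pE; have H (n : nat) (j : int) : E (j + T%:Z * n%:Z) <-> E j.
  elim: n => [|n IH]; first by rewrite mulr0 addr0.
  by rewrite -addn1 PoszD mulrDr mulr1 addrA pE.
case: m => n; first exact: H.
by rewrite NegzE mulrN -(H n.+1 (k - _)) subrK.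
Qed.

Lemma periodic_mul T m E : periodic T E -> periodic (T * m)%N E.
Proof. by move=> pE k; rewrite PoszM; exact: periodic_mulz. Qed.

Lemma periodicI T E F : periodic T E -> periodic T F -> periodic T (E `&` F).
Proof. by move=> pE pF k; split=> -[/pE ? /pF ?]. Qed.

Lemma periodicC T E : periodic T E -> periodic T (~` E).
Proof. by move=> pE k; split => h /pE /h. Qed.

Lemma sum_one_period (R : realType) (T : nat) (E : set int) (k : int) :
  periodic T E ->
  \sum_(0 <= i < T) \1_E (k + i%:Z) = \sum_(0 <= i < T) \1_E i%:Z :> R.
Proof.
move=> pE.
have step (j : int) : \sum_(0 <= i < T) \1_E (j + 1 + i%:Z) =
    \sum_(0 <= i < T) \1_E (j + i%:Z) :> R.
  case: T pE => [|T] pE; first by rewrite !big_geq.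
  rewrite big_nat_recr // [RHS]big_nat_recl //= addrC; congr (_ + _).
    rewrite !indicE; congr (nat_of_bool _)%:R; apply/idP/idP.
      move/set_mem; rewrite -addrA -intS => h; apply/mem_set.
      by apply/pE; rewrite addr0.
    move/set_mem => h; apply/mem_set; rewrite -addrA -intS; apply/pE.
    by rewrite addr0 in h.
  by apply: eq_big_nat => i _; rewrite -addrA -intS.
have stepn (n : nat) (j : int) : \sum_(0 <= i < T) \1_E (j + n%:Z + i%:Z) =
    \sum_(0 <= i < T) \1_E (j + i%:Z) :> R.
  elim: n => [|n IH]; first by rewrite addr0.
  by rewrite -addn1 PoszD addrA step IH.
have -> : \sum_(0 <= i < T) \1_E i%:Z = \sum_(0 <= i < T) \1_E (0 + i%:Z) :> R.
  by apply: eq_bigr => i _; rewrite add0r.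
case: k => n; first by rewrite -(stepn n 0) add0r.
by rewrite NegzE -(stepn n.+1 (- _)) addNr.
Qed.

Section Mean.
Variable R : realType.

(** Finitely additive shift-invariant probabilities.  Positivity is stated for
finite combinations of indicator functions, so that every linear inequality or
identity between indicators passes to the mean. *)
Record shift_mean (L : set int -> R) : Prop := ShiftMean {
  mean_pos : forall s : seq (R * set int),
    (forall k, 0 <= \sum_(p <- s) p.1 * \1_(p.2) k) ->
    0 <= \sum_(p <- s) p.1 * L p.2;
  mean_setT : L setT = 1;
  mean_succ : forall E, L [set k | E (k + 1)] = L E }.

Section Theory.
Variables (L : set int -> R) (hL : shift_mean L).

Lemma mean_eq (s : seq (R * set int)) :
  (forall k, \sum_(p <- s) p.1 * \1_(p.2) k = 0) ->
  \sum_(p <- s) p.1 * L p.2 = 0.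
Proof.
move=> h; apply/le_anti/andP; split; last by apply: (mean_pos hL) => k; rewrite h.
have := mean_pos hL (s := [seq (- p.1, p.2) | p <- s]).
rewrite big_map (eq_bigr (fun p => - (p.1 * L p.2))) /=; last first.
  by move=> p _; rewrite mulNr.
rewrite sumrN oppr_ge0; apply => k; rewrite big_map.
rewrite (eq_bigr (fun p => - (p.1 * \1_(p.2) k))) ?sumrN ?h ?oppr0 //.
by move=> p _; rewrite mulNr.
Qed.

Lemma mean_le (A B : set int) : A `<=` B -> L A <= L B.
Proof.
move=> AB; have := mean_pos hL (s := [:: (1, B); (-1, A)]).
rewrite !big_cons !big_nil /= !mul1r mulN1r addr0 subr_ge0; apply => k.
rewrite !big_cons !big_nil /= !mul1r mulN1r addr0 subr_ge0 !indicE ler_nat.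
by case: (boolP (k \in A)) => // /set_mem /AB /mem_set ->.
Qed.

Lemma mean_ge0 A : 0 <= L A.
Proof.
have := mean_pos hL (s := [:: (1, A)]).
by rewrite !big_cons !big_nil /= mul1r addr0; apply => k; rewrite big_seq1 mul1r.
Qed.

Lemma mean_le1 A : L A <= 1.
Proof. by rewrite -(mean_setT hL); exact: mean_le. Qed.

Lemma mean_split (A B : set int) : L A = L (A `&` B) + L (A `\` B).
Proof.
have := mean_eq (s := [:: (1, A); (-1, A `&` B); (-1, A `\` B)]).
rewrite !big_cons !big_nil /= mul1r !mulN1r addr0 => h; apply/eqP.
rewrite -subr_eq0 opprD; apply/eqP/h => k.
rewrite !big_cons !big_nil /= mul1r !mulN1r addr0 !indicE in_setI in_setD.
by case: (k \in A); case: (k \in B); rewrite /= ?mulr1n ?mulr0n; lra.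
Qed.

Lemma meanC A : L (~` A) = 1 - L A.
Proof.
rewrite -(mean_setT hL) (mean_split setT A) setTI -setTD.
by rewrite addrAC subrr add0r.
Qed.

Lemma meanU (A B : set int) : L (A `|` B) <= L A + L B.
Proof.
rewrite (mean_split (A `|` B) A) setUK lerD2l; apply: mean_le.
by move=> k [[]//].
Qed.

Lemma mean_bigcup (I : Type) (s : seq I) (E : I -> set int) :
  L (\big[setU/set0]_(i <- s) E i) <= \sum_(i <- s) L (E i).
Proof.
elim: s => [|i s IH]; rewrite ?big_nil ?big_cons.
  have := mean_split set0 set0.
  by rewrite setI0 set0D => h; lra.
by apply: le_trans (meanU _ _) _; rewrite lerD2l.
Qed.

Lemma mean_shiftz E (t : int) : L [set k | E (k + t)] = L E.
Proof.
have H (n : nat) F : L [set k | F (k + n%:Z)] = L F.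
  elim: n => [|n IH]; first by congr L; apply/seteqP; split => k /=; rewrite addr0.
  rewrite -IH -(mean_succ hL [set k | F (k + n%:Z)]); congr L.
  by apply/seteqP; split => k /=; rewrite -addrA -intS.
case: t => n; first exact: H.
rewrite -(H n.+1 [set k | _]); congr L; apply/seteqP; split => k /=.
  by rewrite NegzE addrK.
by rewrite NegzE addrK.
Qed.

(** The translates of E by 0, ..., T-1 cover every integer equally often. *)
Lemma mean_periodic T E : (0 < T)%N -> periodic T E ->
  T%:R * L E = \sum_(0 <= i < T) \1_E i%:Z.
Proof.
move=> T0 pE; set c : R := \sum_(0 <= i < T) \1_E i%:Z.
have := mean_eq (s := (- c, setT) ::
  [seq (1, [set k : int | E (k + i%:Z)]) | i <- index_iota 0 T]).
rewrite big_cons big_map /= (mean_setT hL) mulr1.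
rewrite (eq_bigr (fun=> L E)) => [|i _]; last by rewrite mul1r mean_shiftz.
rewrite big_const_nat subn0 iter_addr addr0 -[X in _ + X = 0]mulr_natl => h.
apply/eqP; rewrite -subr_eq0 addrC; apply/eqP/h => k.
rewrite big_cons big_map /= indicT mulr1 /c -(sum_one_period _ k pE).
rewrite [X in _ + X](eq_bigr (fun i : nat => \1_E (k + i%:Z))) ?addNr //.
by move=> i _; rewrite mul1r.
Qed.

(** The traces of E on the residue classes modulo a are translates of each
other, by multiples of T. *)
Lemma mean_coprime_class T a E (r : int) : (0 < a)%N -> coprime T a ->
  periodic T E ->
  a%:R * L (E `&` [set k | (k == r %[mod a])%Z]) = L E.
Proof.
move=> a0 coTa pE.
pose C (r : int) := [set k : int | (k == r %[mod a])%Z].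
have shiftC (i : nat) : L (E `&` C (r + T%:Z * i%:Z)) = L (E `&` C r).
  rewrite -(mean_shiftz (E `&` C (r + T%:Z * i%:Z)) (T%:Z * i%:Z)); congr L.
  apply/seteqP; split => k /= [].
    by move/(periodic_mulz _ _ pE) => Ek; rewrite /C /= eqz_modDr; split.
  by move=> Ek h; split; [apply/(periodic_mulz _ _ pE) | rewrite /C /= eqz_modDr].
have := mean_eq (s := (-1, E) ::
  [seq (1, E `&` C (r + T%:Z * i%:Z)) | i <- index_iota 0 a]).
rewrite big_cons big_map /= (eq_bigr (fun=> L (E `&` C r))); last first.
  by move=> i _; rewrite mul1r shiftC.
rewrite big_const_nat subn0 iter_addr addr0 -[X in _ + X = 0]mulr_natl mulN1r => h.
apply/eqP; rewrite -subr_eq0 addrC; apply/eqP/h => k.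
rewrite big_cons big_map /= mulN1r.
have [kE|kE] := boolP (k \in E); last first.
  rewrite indicE (negbTE kE) oppr0 add0r big1 // => i _.
  by rewrite mul1r indicE in_setI (negbTE kE).
have [i0 [i0a Hi0]] : exists i0 : nat, (i0 < a)%N /\
    forall i, (i < a)%N -> (k == r + T%:Z * i%:Z %[mod a])%Z = (i == i0).
  have /coprimezP[[x y] /= xy] : coprimez T a by rewrite /coprimez /gcdz /= (eqP coTa).
  have a0z : (a%:Z != 0) by rewrite eqz_nat -lt0n.
  exists (absz (((k - r) * x) %% a)%Z).
  have i0E : ((absz (((k - r) * x) %% a)%Z)%:Z = (((k - r) * x) %% a)%Z).
    by rewrite gez0_abs // modz_ge0.
  split; first by rewrite -ltz_nat i0E ltz_pmod // ltz_nat.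
  move=> i ia; rewrite -eqz_nat i0E.
  have -> : (i%:Z == (((k - r) * x) %% a)%Z) = (i%:Z == (k - r) * x %[mod a])%Z.
    by rewrite (modz_small (m := i%:Z)) // ltz_nat ia andbT.
  rewrite !eqz_mod_dvd.
  (* Bezout: x T + y a = 1 *)
  have E1 : k - (r + T%:Z * i%:Z) = - T%:Z * (i%:Z - (k - r) * x) + a%:Z * (y * (k - r)).
    have -> : k - (r + T%:Z * i%:Z) = (k - r) * (x * T%:Z + y * a%:Z) - T%:Z * i%:Z.
      by rewrite xy; ring.
    by ring.
  rewrite E1 rpredDr; last exact: dvdz_mulr _ (dvdzz _).
  rewrite mulNr rpredN Gauss_dvdzr //.
  by rewrite /coprimez /gcdz /= gcdnC (eqP coTa).
rewrite (bigD1_seq i0) ?iota_uniq ?mem_index_iota //= big_nat_cond big1 => [|i].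
  rewrite addr0 mul1r !indicE in_setI kE.
  by rewrite (_ : k \in C _) ?addNr //; apply/mem_set; rewrite /C /= Hi0.
move=> /andP[/andP[_ ia] ii0].
rewrite mul1r indicE in_setI kE (_ : k \in C _ = false) //.
by apply/negP => /set_mem; rewrite /C /= Hi0 // (negbTE ii0).
Qed.

End Theory.
End Mean.

(** * A mean continuous along sets of multiples *)

Definition upto (N : nat) (A : set nat) : set nat := A `&` [set a | (a <= N)%N].

Lemma multiplesP (A : set nat) (k : int) :
  multiples A k <-> exists2 a, A a & (a%:Z %| k)%Z.
Proof.
split=> [[a Aa [q _ <-]]|[a Aa /dvdzP[q ->]]]; exists a => //.
  exact: dvdz_mulr (dvdzz _).
by exists q; rewrite // mulrC.
Qed.

Lemma multiples_sub (A B : set nat) : A `<=` B -> multiples A `<=` multiples B.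
Proof. by move=> AB k /multiplesP[a /AB Ba ak]; apply/multiplesP; exists a. Qed.

Lemma multiples_periodic (A : set nat) (T : nat) :
  (forall a, A a -> (a %| T)%N) -> periodic T (multiples A).
Proof.
move=> AT k; split=> /multiplesP[a Aa ak]; apply/multiplesP; exists a => //.
  by move: ak; rewrite rpredDr // dvdzE AT.
by rewrite rpredDr // dvdzE AT.
Qed.

Lemma multiples_upto_periodic (A : set nat) (N : nat) : pos_set A ->
  periodic N`! (multiples (upto N A)).
Proof.
move=> pA; apply: multiples_periodic => a [Aa /= aN].
by rewrite dvdn_fact // pA.
Qed.

Section ExistsMean.
Variable R : realType.

Lemma ultra_bounded_cvg (G : set_system nat) (v : nat -> R) : UltraFilter G ->
  (forall j, 0 <= v j <= 1) -> cvg (v @ G).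
Proof.
move=> UG v01.
have PG : ProperFilter G by exact: ultra_proper.
have [p [_ clp]] : `[0, 1]%classic `&` cluster (v @ G) !=set0.
  apply: (@segment_compact R 0 1); rewrite /nbhs /=.
  by apply: filterE => j; rewrite /= in_itv /=.
apply/cvg_ex; exists p => A Ap.
have [//|GA] := in_ultra_setVsetC (v @^-1` A) UG.
have [x [/= nAx Ax]] := clp (~` A) A GA Ap.
by [].
Qed.

(** The last field is a countable additivity along truncations, which finitely
additive means need not satisfy. *)
Record sieve_mean (L : set int -> R) : Prop := SieveMean {
  sieve_shift_mean : shift_mean L;
  sieve_lower_density : forall E, lower_density R E <= L E;
  sieve_multiples : forall A, pos_set A -> forall e, 0 < e ->
    exists N, L (multiples A) <= L (multiples (upto N A)) + e }.

Definition wavg (K : nat) (u : nat -> R) (E : set int) : R :=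
  \sum_(1 <= k < K.+1) u k * \1_E k%:Z.

Lemma wavg_ge0 K u E : (forall k, 0 <= u k) -> 0 <= wavg K u E.
Proof.
by move=> u0; apply: sumr_ge0 => k _; rewrite mulr_ge0 // indicE ler0n.
Qed.

Lemma wavg_le K u E : (forall k, 0 <= u k) ->
  wavg K u E <= \sum_(1 <= k < K.+1) u k.
Proof.
by move=> u0; apply: ler_sum => k _; rewrite -[leRHS]mulr1 ler_wpM2l.
Qed.

Lemma wavg_succ K u E : (forall k, 0 <= u k) ->
  (forall k, (0 < k)%N -> u k.+1 <= u k) ->
  `|wavg K u [set k | E (k + 1)] - wavg K u E| <= u 1%N.
Proof.
move=> u0 u_anti; pose a k : R := \1_E k.+1%:Z - \1_E k%:Z.
have aE n : \sum_(1 <= k < n.+1) a k = \1_E n.+1%:Z - \1_E 1%:Z.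
  by rewrite (telescope_sumr (fun k : nat => \1_E k%:Z : R)).
have i01 (k : int) : 0 <= (\1_E k : R) <= 1 by rewrite indicE ler0n lern1 leq_b1.
have -> : wavg K u [set k | E (k + 1)] - wavg K u E =
    \sum_(1 <= k < K.+1) u k * a k.
  rewrite /wavg -sumrB; apply: eq_bigr => k _; rewrite -mulrBr /a.
  by rewrite -addn1 PoszD.
rewrite ler_norml; apply/andP; split.
  rewrite -[u 1%N]mul1r; apply: abel_bound => // n; rewrite aE.
  by have := i01 n.+1; have := i01 1%:Z; lra.
rewrite -lerN2 -sumrN (eq_bigr (fun k => u k * (- a k))); last first.
  by move=> k _; rewrite mulrN.
rewrite -[u 1%N]mul1r; apply: abel_bound => // n; rewrite sumrN aE.
by have := i01 n.+1; have := i01 1%:Z; lra.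
Qed.

(** Decreasing weights are mixtures of uniform weights on initial segments, and
only the short segments can have a frequency below c. *)
Lemma wavg_freq K u E (c : R) (L0 : nat) :
  (forall k, 0 <= u k) -> (forall k, (0 < k)%N -> u k.+1 <= u k) -> c <= 1 ->
  (forall L, (L0 <= L)%N -> c <= freq R E L) ->
  c * (\sum_(1 <= k < K.+1) u k) - L0%:R * u 1%N <= wavg K u E.
Proof.
move=> u0 u_anti c1 hc.
have := @abel_bound R u (fun k => \1_E k%:Z - c) L0%:R K u0 u_anti.
have -> : \sum_(1 <= k < K.+1) u k * (\1_E k%:Z - c) =
    wavg K u E - c * \sum_(1 <= k < K.+1) u k.
  rewrite mulr_sumr -sumrB; apply: eq_bigr => k _.
  by rewrite mulrBr [c * _]mulrC.
set S := \sum_(_ <= _ < _) u _ => H.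
suff : - (L0%:R * u 1%N) <= wavg K u E - c * S by lra.
apply: H => n; rewrite sumrB big_const_nat subSS subn0 iter_addr addr0.
have S0 : 0 <= \sum_(1 <= k < n.+1) \1_E k%:Z :> R.
  by apply: sumr_ge0 => k _; rewrite indicE ler0n.
have [nL|nL] := leqP L0 n.
  have := hc n nL; rewrite /freq; case: n nL S0 => [|n] nL S0.
    by move=> _; rewrite !big_geq // mulr0n subr0; have := ler0n R L0; lra.
  rewrite ler_pdivlMr ?ltr0n // natr_sum -[c *+ _]mulr_natr => h.
  have := ler0n R L0; suff : c * n.+1%:R <= \sum_(1 <= k < n.+2) \1_E k%:Z by lra.
  by apply: le_trans h _; apply: ler_sum => k _; rewrite indicE.
rewrite -[c *+ _]mulr_natr.
have nL' : n%:R <= L0%:R :> R by rewrite ler_nat ltnW.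
have n0 : 0 <= n%:R :> R by rewrite ler0n.
by nra.
Qed.

(** An ultralimit of averages with the weights of [divisor_dominated_weights].
Shift invariance holds because the weights are decreasing and uniformly small.
Continuity along sets of multiples holds because, at each stage K, only the
elements of A up to K matter, and the average is then at most the density of
the periodic set [multiples (upto K A)]. *)
Lemma exists_sieve_mean : exists L, sieve_mean L.
Proof.
have /choice[Ku HKu] : forall j : nat, exists Ku : nat * (nat -> R),
    [/\ forall k, 0 <= Ku.2 k,
        forall k, (0 < k)%N -> Ku.2 k.+1 <= Ku.2 k,
        Ku.2 1%N <= j.+1%:R^-1,
        1 - j.+1%:R^-1 <= \sum_(1 <= k < Ku.1.+1) Ku.2 k <= 1 &
        forall (T : nat) (M : nat -> bool), (0 < T)%N ->
          (forall k n, (k %| n)%N -> M k -> M n) ->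
          (forall n, M (n + T)%N = M n) ->
          T%:R * \sum_(1 <= k < Ku.1.+1) Ku.2 k * (M k)%:R <=
            \sum_(1 <= n < T.+1) (M n)%:R].
  move=> j; have [|K [u H]] := @divisor_dominated_weights R j.+1%:R^-1.
    by rewrite invr_gt0.
  by exists (K, u).
pose U j E := wavg (Ku j).1 (Ku j).2 E.
have [G [UG FG]] := ultraFilterLemma eventually_filter.
have PG : ProperFilter G by exact: ultra_proper.
have U01 j E : 0 <= U j E <= 1.
  have [u0 _ _ /andP[_ u1] _] := HKu j.
  by rewrite wavg_ge0 //= (le_trans (wavg_le _ _ u0)).
have cvgU E : cvg ((fun j => U j E) @ G) by apply: ultra_bounded_cvg.
have cvg0 (C : R) : (fun j : nat => C * j.+1%:R^-1) @ G --> (0 : R).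
  have : (fun j : nat => C * j.+1%:R^-1) @ \oo --> (C * 0 : R).
    apply: cvgMl_tmp; exact: (@cvg_harmonic R).
  by rewrite mulr0 => h A /h hA; apply: FG.
have lim_le (v w : nat -> R) C : cvg (v @ G) -> cvg (w @ G) ->
    (forall j, v j <= w j + C * j.+1%:R^-1) -> lim (v @ G) <= lim (w @ G).
  move=> cv cw vw.
  have -> : lim (w @ G) = lim ((fun j : nat => w j + C * j.+1%:R^-1) @ G).
    apply/esym/cvg_lim => //; rewrite -[lim _]addr0.
    by apply: cvgD; [exact: cw | exact: cvg0].
  apply: ler_lim => //; last by apply: filterE.
  by apply: is_cvgD => //; apply/cvg_ex; exists 0; exact: cvg0.
pose L E := lim ((fun j => U j E) @ G).
have lim_cst (c : R) : lim ((fun=> c) @ G) = c by apply: lim_cst.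
have sm : shift_mean L.
  split.
  - move=> s hs.
    have H : (fun j => \sum_(p <- s) p.1 * U j p.2) @ G -->
        \sum_(p <- s) p.1 * L p.2.
      elim: (s) => [|p r IH].
        rewrite big_nil (_ : (fun _ => _) = cst 0); first exact: cvg_cst.
        by apply/funext => j; rewrite big_nil.
      rewrite big_cons (_ : (fun _ => _) = (fun j => p.1 * U j p.2 +
         \sum_(p <- r) p.1 * U j p.2)); last first.
        by apply/funext => j; rewrite big_cons.
      by apply: cvgD => //; apply: cvgMl_tmp; exact: cvgU.
    rewrite -(cvg_lim _ H) //; apply: limr_ge; first by apply/cvg_ex; eexists; exact: H.
    apply: filterE => j; have [u0 _ _ _ _] := HKu j.
    rewrite /U /wavg.
    under eq_bigr do rewrite mulr_sumr.
    rewrite exchange_big /=; apply: sumr_ge0 => k _.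
    under eq_bigr do rewrite mulrCA.
    by rewrite -mulr_sumr mulr_ge0.
  - apply/le_anti/andP; split.
      rewrite -[leRHS]lim_cst; apply: (lim_le _ _ 0) => //; first exact: is_cvg_cst.
      by move=> j; rewrite mul0r addr0; case/andP: (U01 j setT).
    rewrite -[leLHS]lim_cst; apply: (lim_le _ _ 1) => //; first exact: is_cvg_cst.
    move=> j; have [_ _ _ /andP[h _] _] := HKu j.
    rewrite mul1r -lerBlDr; apply: le_trans h _.
    by apply/eqle/eq_bigr => k _; rewrite indicT mulr1.
  - move=> E; apply/le_anti/andP; split; apply: (lim_le _ _ 1) => // j;
      have [u0 ua u1 _ _] := HKu j;
      have := wavg_succ (Ku j).1 E u0 ua; rewrite ler_norml => /andP[h1 h2];
      rewrite mul1r /U; move: (j.+1%:R^-1) u1 => a; lra.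
exists L; split => //.
- move=> E; apply/ler_addgt0Pr => e e0; rewrite -lerBlDr.
  have [L0 HL0] := @lower_density_freq R E e e0.
  rewrite -[leLHS]lim_cst; set c := _ - e in HL0 *.
  apply: (lim_le _ _ (`|c| + L0%:R)) => //; first exact: is_cvg_cst.
  move=> j; have [u0 ua u1 /andP[s1 s2] _] := HKu j.
  have c1 : c <= 1.
    by apply: le_trans (HL0 L0 (leqnn _)) _; case/andP: (freq01 R E L0).
  have := wavg_freq (Ku j).1 u0 ua c1 HL0; rewrite -/(U j E).
  move: s1 s2; set S := \sum_(_ <= _ < _) _ => s1 s2 hU.
  have t1 : c * (1 - S) <= `|c| * j.+1%:R^-1.
    apply: le_trans (ler_norm _) _; rewrite normrM ler_wpM2l //.
    by rewrite ger0_norm ?subr_ge0 // lerBlDr addrC -lerBlDr.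
  have t2 : L0%:R * (Ku j).2 1%N <= L0%:R * j.+1%:R^-1 by rewrite ler_wpM2l.
  rewrite mulrDl; move: (j.+1%:R^-1) t1 t2 => a t1 t2.
  by rewrite mulrBr mulr1 in t1; lra.
move=> A pA e e0; apply: contrapT => /forallNP H.
suff : L (multiples A) <= L (multiples A) - e.
  by rewrite lerBrDr gerDl leNgt e0.
rewrite -[X in _ <= X]lim_cst.
apply: (lim_le _ _ 0) => //; first exact: is_cvg_cst.
move=> j; rewrite mul0r addr0; have {H} := H (Ku j).1.
move=> /negP; rewrite -ltNge => /ltW H; rewrite lerBrDr.
apply: le_trans H; rewrite lerD2r.
set K := (Ku j).1; have [u0 ua _ _ DE] := HKu j.
have T0 : 0 < K`!%:R :> R by rewrite ltr0n fact_gt0.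
rewrite -(ler_pM2l T0) (mean_periodic sm) ?fact_gt0 //; last first.
  exact: multiples_upto_periodic.
have := DE K`! (fun n => n%:Z \in multiples (upto K A)) (fact_gt0 _).
have -> : U j (multiples A) = \sum_(1 <= k < K.+1)
    (Ku j).2 k * (k%:Z \in multiples (upto K A))%:R.
  apply: eq_big_nat => k /andP[k0 kK]; rewrite indicE; congr (_ * _%:R).
  congr nat_of_bool; apply/idP/idP => /set_mem /multiplesP [a Aa ak];
    apply/mem_set/multiplesP; exists a => //; last by case: Aa.
  split => //=; apply: leq_trans (_ : k <= _)%N => //.
  by apply: dvdn_leq.
have -> : \sum_(0 <= i < K`!) \1_(multiples (upto K A)) i%:Z =
    \sum_(1 <= n < K`!.+1) (n%:Z \in multiples (upto K A))%:R :> R.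
  rewrite -(sum_one_period _ 1 (multiples_upto_periodic _ _)) //.
  by rewrite big_add1 /=; apply: eq_bigr => i _; rewrite indicE -intS.
apply.
  move=> k n kn /set_mem /multiplesP[a Aa ak]; apply/mem_set/multiplesP.
  by exists a => //; rewrite dvdzE /=; apply: dvdn_trans kn; rewrite dvdzE in ak.
have pE := multiples_upto_periodic K pA.
by move=> n; rewrite PoszD; apply/idP/idP => /set_mem h; apply/mem_set/pE.
Qed.
End ExistsMean.

(** * Coprime selection and the Chinese remainder theorem *)

Section CoprimeSelection.

Definition avoiding (A : set nat) : Prop :=
  forall N, (0 < N)%N -> exists2 a, A a & (0 < a)%N /\ coprime a N.

Lemma avoiding1 : avoiding [set 1%N].
Proof. by move=> N _; exists 1%N => //; rewrite coprime1n. Qed.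

(** Distinct members that share a factor with N have distinct least common
primes with N, so that there are finitely many of them. *)
Lemma avoiding_pairwise_coprime A : pos_set A -> infinite_set A ->
  pairwise_coprime A -> avoiding A.
Proof.
move=> pA iA cA N N0; apply: contrapT => H; apply: iA.
have nc a : A a -> ~~ coprime a N.
  move=> Aa; apply/negP => co; apply: H; exists a => //; split => //.
  exact: pA.
pose f a := pdiv (gcdn a N).
have fp a : A a -> prime (f a) /\ (f a %| a)%N /\ (f a %| N)%N.
  move=> Aa; have g1 : (1 < gcdn a N)%N.
    rewrite ltn_neqAle gcdn_gt0 N0 orbT andbT eq_sym; exact: nc.
  by rewrite pdiv_prime // !(dvdn_trans (pdiv_dvd _)) ?dvdn_gcdl ?dvdn_gcdr.
have f_inj : {in A &, injective f}; last first.
  rewrite -(eq_finite_set (inj_card_eq f_inj)).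
  apply: (@sub_finite_set _ _ `I_N.+1); last exact: finite_II.
  by move=> _ [a Aa <-] /=; have [_ [_ h]] := fp a Aa; rewrite ltnS dvdn_leq.
move=> a b /set_mem Aa /set_mem Ab fab; apply: contrapT => ab.
have [pp [pa _]] := fp a Aa; have [_ [pb _]] := fp b Ab.
have /eqP co := cA a b Aa Ab ab.
have : (f a %| gcdn a b)%N by rewrite dvdn_gcd pa fab pb.
by rewrite co dvdn1; apply/negP; rewrite neq_ltn prime_gt1 ?orbT.
Qed.

Lemma coprime_choice (n N : nat) (A : nat -> set nat) : (0 < N)%N ->
  (forall z, avoiding (A z)) ->
  exists a : nat -> nat, forall z, (z < n)%N ->
    [/\ A z (a z), (0 < a z)%N & coprime (a z) (N * \prod_(0 <= i < z) a i)].
Proof.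
move=> N0 avA; elim: n => [|n [a Ha]]; first by exists (fun=> 1%N).
have [|b Ab [b0 cob]] := avA n (N * \prod_(0 <= i < n) a i)%N.
  rewrite muln_gt0 N0 /= big_nat_cond prodn_cond_gt0 // => i.
  by rewrite andbT => /andP[_ /Ha[]].
pose a' z := if (z < n)%N then a z else b.
have E z : (z <= n)%N -> (\prod_(0 <= i < z) a' i = \prod_(0 <= i < z) a i)%N.
  move=> zn; apply: eq_big_nat => i /andP[_ iz].
  by rewrite /a' (leq_trans iz zn).
exists a' => z; rewrite ltnS leq_eqVlt => /predU1P[->|zn].
  by rewrite E // /a' ltnn; split.
have [Aa a0 co] := Ha z zn.
by rewrite E ?(ltnW zn) // /a' zn; split.
Qed.

Lemma chinese_seq (n M : nat) (a : nat -> nat) (r : nat -> int) :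
  (forall z, (z < n)%N -> coprime (a z) (M * \prod_(0 <= i < z) a i)) ->
  exists k : int, (M%:Z %| k)%Z /\
    forall z, (z < n)%N -> ((a z)%:Z %| k - r z)%Z.
Proof.
elim: n => [|n IH] co; first by exists 0; rewrite dvdz0.
have [z zn|k [Mk Hk]] := IH; first exact/co/ltnW.
pose P := (M * \prod_(0 <= i < n) a i)%N.
have coP : coprimez P%:Z (a n)%:Z.
  by rewrite coprimezE /= coprime_sym; exact: co.
have PMk z : (z < n)%N -> ((a z)%:Z %| P%:Z)%Z.
  move=> zn; rewrite dvdzE /= /P dvdn_mull //.
  by rewrite (bigD1_seq z) ?iota_uniq ?mem_index_iota //= dvdn_mulr.
pose k' := zchinese P%:Z (a n)%:Z k (r n).
have E1 : (P%:Z %| k' - k)%Z.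
  by rewrite -eqz_mod_dvd; apply/eqP; exact: zchinese_modl.
have E2 : ((a n)%:Z %| k' - r n)%Z.
  by rewrite -eqz_mod_dvd; apply/eqP; exact: zchinese_modr.
exists k'; split.
  rewrite -(subrK k k') rpredD //; apply: dvdz_trans E1.
  by rewrite dvdzE /= dvdn_mulr.
move=> z; rewrite ltnS leq_eqVlt => /predU1P[->//|zn].
rewrite (_ : k' - r z = (k' - k) + (k - r z)); last by ring.
by rewrite rpredD ?Hk //; apply: dvdz_trans (PMk z zn) E1.
Qed.

End CoprimeSelection.

Lemma free_charE (B : set nat) z : free_char B z = (z \notin multiples B).
Proof. by rewrite /free_char /free_set in_setC. Qed.

Lemma prim_dvd (A : set nat) a : pos_set A -> A a ->
  exists2 b, prim A b & (b %| a)%N.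
Proof.
move=> pA; elim/ltn_ind: a => a IH Aa.
have [ap|nap] := pselect (prim A a); first by exists a.
have [b [Ab ba bNa]] : exists b, [/\ A b, (b %| a)%N & b <> a].
  apply: contrapT => H; apply: nap; split => // b Ab ba.
  by apply: contrapT => bNa; apply: H; exists b.
have [|c pc cb] := IH b _ Ab.
  by rewrite ltn_neqAle (introN eqP bNa) dvdn_leq // pA.
by exists c => //; apply: dvdn_trans cb ba.
Qed.

Lemma multiples_prim (A : set nat) : pos_set A -> multiples (prim A) = multiples A.
Proof.
move=> pA; apply/seteqP; split; first by apply: multiples_sub => a [].
move=> k /multiplesP[a Aa ak]; have [b pb ba] := prim_dvd pA Aa.
by apply/multiplesP; exists b => //; apply: dvdz_trans ak; rewrite dvdzE.
Qed.

Lemma pos_setUD (B : set nat) : pos_set B -> pos_set (B `|` D_set B).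
Proof. by move=> pB b [/pB|[]]. Qed.

Lemma pos_Bstar (B : set nat) : pos_set B -> pos_set (Bstar B).
Proof. by move=> pB b [/(pos_setUD pB)]. Qed.

Lemma multiples_Bstar (B : set nat) : pos_set B ->
  multiples (Bstar B) = multiples B `|` multiples (D_set B).
Proof.
move=> pB; rewrite multiples_prim; last exact: pos_setUD.
apply/seteqP; split => [k /multiplesP[a [Aa|Da] ak]|k [|]].
- by left; apply/multiplesP; exists a.
- by right; apply/multiplesP; exists a.
- by apply: multiples_sub => a; left.
- by apply: multiples_sub => a; right.
Qed.

Lemma D_set_avoiding (B : set nat) d : D_set B d ->
  avoiding [set a | B (d * a)%N].
Proof.
move=> [d0 [A [pA iA cA AB]]] N N0.
by have [a Aa h] := avoiding_pairwise_coprime pA iA cA N0; exists a; [exact: AB|].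
Qed.

Lemma dvdz_coprime_mul (d a : nat) (k : int) : coprime a d ->
  (d%:Z %| k)%Z -> (a%:Z %| k)%Z -> ((d * a)%N%:Z %| k)%Z.
Proof.
by move=> co; rewrite !dvdzE /= => h1 h2; rewrite Gauss_dvd ?h1 // coprime_sym.
Qed.

(** A one of eta* recurs along a progression by the Toeplitz property and forces
a one of eta.  A zero comes from a multiple of an element of B, which recurs, or
from a multiple of some d in [D_set B]; in the latter case it is enough to move
it to a multiple of a, where d a lies in B and a is prime to all other moduli.
The Chinese remainder theorem meets all these requirements at once. *)
Lemma window_Bstar (B : set nat) (n : nat) (s : int) : pos_set B ->
  toeplitz (free_char (Bstar B)) ->
  exists k : int, forall j, (j < n)%N ->
    free_char B (s + j%:Z + k) = free_char (Bstar B) (s + j%:Z).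
Proof.
move=> pB tB; have MB := multiples_Bstar pB.
have H (j : nat) : exists mA : nat * set nat, [/\ (0 < mA.1)%N, avoiding mA.2 &
    forall a (k : int), mA.2 a -> coprime a mA.1 -> (mA.1%:Z %| k)%Z ->
      (a%:Z %| s + j%:Z + k)%Z ->
      free_char B (s + j%:Z + k) = free_char (Bstar B) (s + j%:Z)].
  set x := s + j%:Z; case E : (free_char (Bstar B) x).
    have [m [m0 Hm]] := tB x; exists (m, [set 1%N]); split => //.
      exact: avoiding1.
    move=> a k _ _ /= /dvdzP[q ->] _; move: (Hm q); rewrite E mulrC.
    rewrite !free_charE MB => /negP h; apply/negP => h'; apply: h.
    by apply/mem_set; left; exact: set_mem h'.
  have : multiples (Bstar B) x.
    by move: E; rewrite free_charE => /negbFE /set_mem.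
  rewrite MB => -[] /multiplesP[b Bb bx].
    exists (b, [set 1%N]); split => //=; [exact: pB | exact: avoiding1 |].
    move=> a k _ _ bk _; rewrite free_charE; apply/negbF/mem_set/multiplesP.
    by exists b => //; rewrite rpredD.
  exists (b, [set a | B (b * a)%N]); split => //=; first by case: Bb.
    exact: D_set_avoiding.
  move=> a k Ba co bk ak; rewrite free_charE; apply/negbF/mem_set/multiplesP.
  by exists (b * a)%N => //; apply: dvdz_coprime_mul => //; rewrite rpredD.
have [mA {}H] := choice H.
pose M := (\prod_(0 <= j < n) (mA j).1)%N.
have M0 : (0 < M)%N by rewrite prodn_gt0 // => i; case: (H i).
have [|a Ha] := @coprime_choice n M (fun j => (mA j).2) M0.
  by move=> z; case: (H z).
have [|k [Mk Hk]] := @chinese_seq n M a (fun j => - (s + j%:Z)).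
  by move=> z /Ha[].
exists k => j jn; have [aj _ coj] := Ha j jn; have [m0 _ h] := H j.
have mM : ((mA j).1 %| M)%N.
  by rewrite /M (bigD1_seq j) ?iota_uniq ?mem_index_iota //= dvdn_mulr.
apply: (h (a j)) => //.
- by move: coj; rewrite coprimeMr => /andP[+ _]; apply: coprime_dvdr.
- by apply: dvdz_trans Mk; rewrite dvdzE.
- by have := Hk j jn; rewrite opprK addrC.
Qed.

Lemma card_bigcup_le (T I : finType) (P : pred I) (F : I -> {set T}) :
  (#|(\bigcup_(i | P i) F i)%SET| <= \sum_(i | P i) #|F i|)%N.
Proof.
elim/big_rec2: _ => [|i y C _ IH]; first by rewrite cards0.
by apply: leq_trans (leq_card_setU _ _) _; rewrite leq_add2l.
Qed.

Lemma many_small_sets (n : nat) :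
  (2 ^ n <= 2 * #|[set S : {set 'I_n} | 2 * #|S| <= n]%SET|)%N.
Proof.
rewrite mul2n -addnn -[X in (X <= _)%N](_ : #|[set: {set 'I_n}]%SET| = _); last first.
  by rewrite -powersetT card_powerset cardsT card_ord.
set A := [set S | _]%SET.
have -> : ([set: {set 'I_n}]%SET = A :|: ~: A)%SET by rewrite finset.setUCr.
apply: leq_trans (leq_card_setU _ _) _; rewrite leq_add2l.
rewrite -(card_imset _ (@finset.setC_inj _)); apply: subset_leq_card.
apply/fintype.subsetP => S; rewrite !inE => h.
rewrite -[S]finset.setCK; apply: imset_f; rewrite inE.
by have := cardsC S; rewrite card_ord; lia.
Qed.

(** At least half of the subsets S of [0, n) have at most n/2 elements, and a
given w of size at least m is disjoint from at most 2^(n-m) of them. *)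
Lemma disjoint_family_card (n m : nat) (W : {set {set 'I_n}}) :
  (forall S : {set 'I_n}, (2 * #|S| <= n)%N ->
     exists2 w, w \in W & [disjoint S & w] && (m <= #|w|)%N) ->
  (2 ^ m <= 2 * #|W|)%N.
Proof.
move=> H; have mn : (m <= n)%N.
  have [|w _ /andP[_ h]] := H finset.set0; first by rewrite cards0.
  by apply: leq_trans h _; rewrite -[X in (_ <= X)%N]card_ord max_card.
rewrite -(leq_pmul2r (expn_gt0 2 (n - m))) -expnD subnKC //.
apply: leq_trans (many_small_sets n) _; rewrite -mulnA leq_mul2l /=.
(* subsets avoided by w are the subsets of its complement *)
pose V := [set w in W | (m <= #|w|)%N]%SET.
apply: (@leq_trans #|(\bigcup_(w in V) powerset (~: w))%SET|).
  apply: subset_leq_card; apply/fintype.subsetP => S; rewrite inE => /H[w wW /andP[d h]].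
  by apply/finset.bigcupP; exists w; rewrite inE ?wW // -finset.disjoints_subset.
apply: leq_trans (_ : \sum_(w in V) 2 ^ (n - m) <= _)%N; last first.
  rewrite sum_nat_const leq_mul2r subset_leq_card ?orbT //.
  by apply/fintype.subsetP => w; rewrite inE => /andP[].
apply: leq_trans (card_bigcup_le _ _) _; apply: leq_sum => w.
rewrite inE => /andP[_ mw]; rewrite card_powerset leq_exp2l //.
by have := cardsC w; rewrite card_ord; lia.
Qed.

(** * Sieving inside residue classes *)

Definition dvdset (d : nat) : set int := [set k : int | (d%:Z %| k)%Z].

Section SievedClasses.
Variables (R : realType) (L : set int -> R) (hL : sieve_mean L).
Let sm := sieve_shift_mean hL.

Lemma periodicT T : periodic T setT. Proof. by []. Qed.

Lemma periodic_dvdset d : periodic d (dvdset d).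
Proof. by move=> k; rewrite /dvdset /= rpredDr // dvdzz. Qed.

Lemma mean_dvdset_class (d a : nat) (r : int) : (0 < d)%N -> (0 < a)%N ->
  coprime d a ->
  L (dvdset d `&` [set k | (k == r %[mod a])%Z]) = (d%:R * a%:R)^-1.
Proof.
move=> d0 a0 co; have dR : d%:R != 0 :> R by rewrite pnatr_eq0 -lt0n.
have aR : a%:R != 0 :> R by rewrite pnatr_eq0 -lt0n.
apply: (mulfI aR); rewrite (mean_coprime_class sm _ a0 co); last first.
  exact: periodic_dvdset.
rewrite invfM mulrC -mulrA mulVf // mulr1; apply: (mulfI dR); rewrite divff //.
rewrite -[RHS](mean_setT sm) -(mean_coprime_class sm 0 d0 (coprime1n d) (@periodicT 1)).
congr (_ * L _); apply/seteqP; split => k; rewrite /dvdset /=.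
  by move=> h; split=> //; rewrite eqz_mod_dvd subr0.
by case=> _; rewrite eqz_mod_dvd subr0.
Qed.

(** For a finite truncation of A the sieved set has a period prime to a, hence is
equidistributed among the residue classes modulo a; continuity of the mean along
sets of multiples removes the truncation. *)
Lemma mean_sieved_class (A : set nat) (d a : nat) (r : int) : pos_set A ->
  (0 < a)%N -> coprime d a -> (forall b, A b -> coprime b a) ->
  a%:R * L (multiples A `&` dvdset d `&` [set k | (k == r %[mod a])%Z]) <=
  L (multiples A `&` dvdset d).
Proof.
move=> pA a0 cod coA; have aR : 0 < a%:R :> R by rewrite ltr0n.
apply/ler_addgt0Pr => e e0; set C := [set k | _].
have ea : 0 < e / a%:R by rewrite divr_gt0.
have [N HN] := sieve_multiples hL pA ea.
pose T := (\prod_(0 <= b < N.+1) if `[< A b >] then b else 1)%N.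
have coT : coprime T a.
  apply: (big_ind (fun t => coprime t a)); first exact: coprime1n.
    by move=> x y cx cy; rewrite coprimeMl cx.
  by move=> b _; case: asboolP => [/coA//|_]; exact: coprime1n.
have pT : periodic T (multiples (upto N A)).
  apply: multiples_periodic => b [Ab /= bN].
  rewrite /T (bigD1_seq b) ?iota_uniq ?mem_index_iota ?ltnS //=.
  by case: asboolP => // _; exact: dvdn_mulr.
have := mean_coprime_class sm r a0 (_ : coprime (T * d) a)
  (periodicI (periodic_mul d pT) _).
rewrite coprimeMl coT cod => /(_ (dvdset d) isT).
have pd : periodic (T * d) (dvdset d) by rewrite mulnC; apply/periodic_mul/periodic_dvdset.
move=> /(_ pd) E1.
have sub : multiples (upto N A) `<=` multiples A by apply: multiples_sub => b [].
have E2 := mean_split sm (multiples A) (multiples (upto N A)).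
rewrite (_ : multiples A `&` multiples (upto N A) = multiples (upto N A)) in E2; last first.
  exact: setIidr.
have H : L (multiples A `&` dvdset d `&` C) <=
    L (multiples (upto N A) `&` dvdset d `&` C) + e / a%:R.
  rewrite (mean_split sm _ (multiples (upto N A))); apply: lerD.
    by apply: (mean_le sm) => k [[[_ ?] ?] ?].
  apply: le_trans (_ : L (multiples A `\` multiples (upto N A)) <= _).
    by apply: (mean_le sm) => k [[[? _] _] ?].
  by lra.
apply: le_trans (ler_wpM2l (ltW aR) H) _; rewrite mulrDr mulrCA divff ?gt_eqF // mulr1.
rewrite lerD2r E1; apply: (mean_le sm) => k [/sub ? ?] //.
Qed.

Definition free_positions (B : set nat) (d n : nat) (k : int) : {set 'I_n} :=
  [set j : 'I_n | free_char B ((d * j)%N%:Z + k)]%SET.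

(** For z in S choose moduli a z with d (a z) in B, pairwise coprime and prime to
d n!, and consider the class C of the k divisible by d for which a z divides
d z + k for every z in S.  On C the positions of S are not free.  For j outside S,
an element of B dividing d j + k is prime to every a z, since a common prime would
divide the difference d (z - j).  So [mean_sieved_class] applies: the
proportion of k in C with d j + k free is at least that of the free integers among
the multiples of d.  Averaging over j gives the required k. *)
Lemma window_avoiding_many (B : set nat) (d n m : nat) (S : {set 'I_n}) :
  pos_set B -> D_set B d ->
  m%:R <= d%:R * L (free_set B `&` dvdset d) * (n - #|S|)%N%:R ->
  exists k, [disjoint S & free_positions B d n k] &&
    (m <= #|free_positions B d n k|)%N.
Proof.
move=> pB Dd; have [d0 _] := Dd.
move=> hm.
pose N0 := (d * n`!)%N; have N00 : (0 < N0)%N by rewrite muln_gt0 d0 fact_gt0.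
(* N0 = d n! so that the moduli have no prime factor in common with d or
   with the differences of positions *)
have [a0 Ha0] := coprime_choice n N00 (fun _ => D_set_avoiding Dd).
pose pS (z : nat) := [exists j in S, val j == z].
have pSE (j : 'I_n) : pS j = (j \in S).
  apply/existsP/idP => [[i /andP[iS /eqP/val_inj <-]]//|jS].
  by exists j; rewrite jS /=.
(* positions outside S impose no congruence *)
pose a z := if pS z then a0 z else 1%N.
have a_dvd z : (\prod_(0 <= i < z) a i %| \prod_(0 <= i < z) a0 i)%N.
  elim/big_rec2: _ => // i x y _ xy; apply: dvdn_mul => //.
  by rewrite /a; case: ifP.
have co z : (z < n)%N -> coprime (a z) (N0 * \prod_(0 <= i < z) a i).
  move=> zn; rewrite /a; case: ifP => _; last exact: coprime1n.
  have [_ _] := Ha0 z zn; apply: coprime_dvdr; exact: dvdn_mul.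
have [k0 [Nk0 Hk0]] := @chinese_seq n N0 a (fun z => - ((d * z)%N%:Z)) co.
pose q := (\prod_(0 <= z < n) a z)%N.
have coq : coprime N0 q.
  rewrite /q big_nat_cond; apply: (big_ind (fun t => coprime N0 t)).
  - exact: coprimen1.
  - by move=> x y cx cy; rewrite coprimeMr cx.
  move=> z; rewrite andbT => /andP[_ zn].
  by have := co z zn; rewrite coprime_sym coprimeMl => /andP[].
have cod : coprime d q by move: coq; rewrite coprimeMl => /andP[].
have q0 : (0 < q)%N.
  rewrite /q big_nat_cond prodn_cond_gt0 // => z /andP[/andP[_ zn] _].
  by rewrite /a; case: ifP => // _; case: (Ha0 z zn).
have aq z : (z < n)%N -> (a z %| q)%N.
  by move=> zn; rewrite /q (bigD1_seq z) ?iota_uniq ?mem_index_iota //= dvdn_mulr.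
pose C := dvdset d `&` [set k | (k == k0 %[mod q])%Z].
have aC z k : C k -> (z < n)%N -> ((a z)%:Z %| (d * z)%N%:Z + k)%Z.
  move=> [_ /=]; rewrite eqz_mod_dvd => qk zn.
  rewrite (_ : _ + k = (k - k0) + (k0 - - (d * z)%N%:Z)); last by ring.
  by rewrite rpredD ?Hk0 //; apply: dvdz_trans qk; rewrite dvdzE aq.
have dC z k : C k -> (d%:Z %| (d * z)%N%:Z + k)%Z.
  by move=> [dk _]; rewrite rpredD // dvdzE dvdn_mulr.
have disj k : C k -> [disjoint S & free_positions B d n k]%B.
  move=> Ck; rewrite finset.disjoints_subset; apply/fintype.subsetP => j jS.
  rewrite !inE free_charE negbK; apply/mem_set/multiplesP.
  have [Ba _ coa] := Ha0 j (ltn_ord j).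
  exists (d * a0 j)%N => //; apply: dvdz_coprime_mul; last 1 first.
  - by have := aC j k Ck (ltn_ord j); rewrite /a pSE jS.
  - by move: coa; rewrite !coprimeMr => /andP[/andP[]].
  - exact: dC.
pose B' := [set b | B b /\ coprime b q].
have pB' : pos_set B' by move=> b [/pB].
have sieve (j : 'I_n) k : C k -> j \notin S ->
    multiples B ((d * j)%N%:Z + k) -> multiples B' ((d * j)%N%:Z + k).
  move=> Ck jS /multiplesP[b Bb bk]; apply/multiplesP; exists b => //; split => //.
  apply: contrapT => /negP nco.
  have g1 : (1 < gcdn b q)%N by rewrite ltn_neqAle gcdn_gt0 q0 orbT andbT eq_sym.
  have pp := pdiv_prime g1; set p := pdiv _ in pp.
  have pb : (p %| b)%N by apply: dvdn_trans (pdiv_dvd _) (dvdn_gcdl _ _).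
  have pq : (p %| q)%N by apply: dvdn_trans (pdiv_dvd _) (dvdn_gcdr _ _).
  have pN0 : ~~ (p %| N0)%N.
    apply/negP => pN; have : (p %| gcdn N0 q)%N by rewrite dvdn_gcd pN.
    by rewrite (eqP coq) dvdn1 => /eqP p1; rewrite p1 in pp.
  have [z [zn pz]] : exists z, (z < n)%N /\ (p %| a z)%N.
    apply: contrapT => H; move: pq; apply/negP; rewrite /q big_nat_cond.
    apply: (big_ind (fun t => ~~ (p %| t)%N)).
    - by rewrite dvdn1; apply/eqP => p1; rewrite p1 in pp.
    - by move=> x y px py; rewrite Euclid_dvdM // negb_or px.
    - by move=> z /andP[/andP[_ zn] _]; apply/negP => pz; apply: H; exists z.
  have zS : pS z.
    move: pz; rewrite /a; case: ifP => // _.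
    by rewrite dvdn1 => /eqP p1; rewrite p1 in pp.
  have zj : z != j by apply: contra jS => /eqP zj; rewrite -pSE -zj.
  have h1 : (p%:Z %| (d * z)%N%:Z + k)%Z.
    by apply: dvdz_trans (aC z k Ck zn); rewrite dvdzE.
  have h2 : (p%:Z %| (d * j)%N%:Z + k)%Z by apply: dvdz_trans bk; rewrite dvdzE.
  have : (p%:Z %| d%:Z * (z%:Z - j%:Z))%Z.
    rewrite (_ : _ * _ = ((d * z)%N%:Z + k) - ((d * j)%N%:Z + k)).
      by rewrite rpredB.
    by rewrite !PoszM; ring.
  rewrite dvdzE abszM /= Euclid_dvdM //; apply/negP; rewrite negb_or.
  apply/andP; split; first by apply: contra pN0 => pd; rewrite /N0 dvdn_mulr.
  apply: contra pN0 => pzj; rewrite /N0 dvdn_mull //; apply: dvdn_trans pzj _.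
  have jn := ltn_ord j.
  by apply: dvdn_fact; apply/andP; split; move: zj jn zn; clear; lia.
have qR : 0 < q%:R :> R by rewrite ltr0n.
have dR : 0 < d%:R :> R by rewrite ltr0n.
have LC : L C = (d%:R * q%:R)^-1 by apply: mean_dvdset_class.
have Ld : L (dvdset d) = d%:R^-1.
  have := mean_dvdset_class 0 d0 (ltn0Sn 0) (coprimen1 d); rewrite mulr1 => <-.
  congr L; apply/seteqP; split => k /=; last by case.
  by move=> h; split => //=; rewrite !modz1.
pose E (j : 'I_n) := C `&` [set k | free_set B ((d * j)%N%:Z + k)].
set beta := L (free_set B `&` dvdset d) in hm *.
have LE j : j \notin S -> beta / q%:R <= L (E j).
  move=> jS; pose X := multiples B' `&` dvdset d `&`
    [set y | (y == k0 + (d * j)%N%:Z %[mod q])%Z].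
  have LX : L X <= L (multiples B `&` dvdset d) / q%:R.
    rewrite ler_pdivlMr // mulrC.
    apply: le_trans (mean_sieved_class _ pB' q0 cod _) _; first by move=> b [].
    by apply: (mean_le sm) => k [h dk]; split => //; apply: multiples_sub h => b [].
  have : L C <= L (E j) + L X.
    rewrite -(mean_shiftz sm X (d * j)%N%:Z) (mean_split sm C (E j)) lerD //.
      by apply: (mean_le sm) => k [].
    apply: (mean_le sm) => k [Ck nE]; have [dk hk] := Ck.
    have Mk : multiples B ((d * j)%N%:Z + k).
      by apply: contrapT => h; apply: nE; split.
    split; first split; rewrite /= addrC; first exact: sieve.
      exact: dC.
    by rewrite [k0 + _]addrC eqz_modDl.
  have := mean_split sm (dvdset d) (multiples B).
  rewrite [_ `\` _]setIC -/(free_set B) -/beta setIC Ld LC => h1 h2.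
  have h3 : L (multiples B `&` dvdset d) = d%:R^-1 - beta by rewrite h1; lra.
  rewrite h3 in LX; have : (d%:R * q%:R)^-1 = d%:R^-1 / q%:R :> R by rewrite invfM.
  move: LX h2; rewrite mulrBl.
  by move: (beta / q%:R) (d%:R^-1 / q%:R) ((d%:R * q%:R)^-1) => x y z; lra.
apply: contrapT => H.
have small k : C k -> (#|free_positions B d n k| < m)%N.
  move=> Ck; rewrite ltnNge; apply/negP => h; apply: H; exists k.
  by rewrite disj.
have Ck0 : C k0.
  split => //=; apply: dvdz_trans Nk0; by rewrite dvdzE /= dvdn_mulr.
have m0 : (0 < m)%N by apply: leq_ltn_trans (small _ Ck0).
have := mean_pos sm (s := (m.-1%:R, C) :: [seq (-1, E j) | j <- enum (~: S)%SET]).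
rewrite big_cons big_map big_enum /= LC.
rewrite (eq_bigr (fun j => - L (E j))) => [|j _]; last by rewrite mulN1r.
rewrite sumrN subr_ge0 => /(_ _)/wrap[].
  move=> k; rewrite big_cons big_map big_enum /=.
  rewrite (eq_bigr (fun j => - \1_(E j) k)) => [|j _]; last by rewrite mulN1r.
  rewrite sumrN subr_ge0; have [Ck|Ck] := pselect (C k); last first.
    rewrite big1 => [|j _]; first by rewrite mulr_ge0 // indicE ler0n.
    by rewrite indicE memNset // => -[].
  rewrite [X in _ * X]indicE mem_set // mulr1.
  apply: (@le_trans _ _ #|free_positions B d n k|%:R); last first.
    by rewrite ler_nat -ltnS prednK // small.
  rewrite -sum1_card natr_sum big_mkcond [leRHS]big_mkcond /=.
  apply: ler_sum => j _; rewrite !inE; case: ifP => _; last by case: ifP.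
  rewrite /free_char indicE in_setI (mem_set Ck) /=.
  by rewrite (_ : (k \in [set k | _]) = (((d * j)%N%:Z + k) \in free_set B))
    ?lern1; first case: ifP.
apply/negP; rewrite -ltNge.
apply: (@lt_le_trans _ _ (\sum_(j in (~: S)%SET) beta / q%:R)); last first.
  by apply: ler_sum => j; rewrite inE => /LE.
rewrite sumr_const cardsCs finset.setCK card_ord -[ltRHS]mulr_natl invfM !mulrA.
rewrite ltr_pM2r ?invr_gt0 // ltr_pdivrMr //.
apply: lt_le_trans (_ : m%:R <= _); first by rewrite ltr_nat prednK.
by apply: le_trans hm _; apply/eqle; ring.
Qed.

End SievedClasses.

(** * Topology and Borel sets of configurations *)

Section Windows.

Definition agree (N : nat) (x y : conf) : Prop :=
  forall i : int, (`|i| <= N)%N -> x i = y i.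

Definition windowed (N : nat) (C : set conf) : Prop :=
  forall x y, agree N x y -> C x -> C y.

(** The largest subset of U that depends on the coordinates in [-N, N] only. *)
Definition core (N : nat) (U : set conf) : set conf :=
  [set x | forall y, agree N x y -> U y].

Lemma agree_sym N x y : agree N x y -> agree N y x.
Proof. by move=> xy i iN; rewrite xy. Qed.

Lemma agree_trans N y x z : agree N x y -> agree N y z -> agree N x z.
Proof. by move=> xy yz i iN; rewrite xy ?yz. Qed.

Lemma agree_le N N' x y : (N <= N')%N -> agree N' x y -> agree N x y.
Proof. by move=> NN xy i iN; apply: xy; apply: leq_trans NN. Qed.

Lemma windowedI N N' C C' : windowed N C -> windowed N' C' ->
  windowed (maxn N N') (C `&` C').
Proof.
move=> wC wC' x y xy [Cx Cx']; split.
  by apply: wC Cx; apply: agree_le xy; rewrite leq_maxl.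
by apply: wC' Cx'; apply: agree_le xy; rewrite leq_maxr.
Qed.

Lemma core_windowed N U : windowed N (core N U).
Proof. by move=> x y xy Ux z yz; apply: Ux; exact: agree_trans yz. Qed.

Lemma core_sub N U : core N U `<=` U.
Proof. by move=> x; apply. Qed.

Lemma agree_nbhs N (x : conf) : nbhs x [set y : conf | agree N x y].
Proof.
have H (i : int) : nbhs x [set y : conf | x i = y i].
  have := @proj_continuous int (fun _ => bool) i x [set b | x i = b].
  by apply; rewrite /= nbhs_principalE //=.
have HN : \forall y \near nbhs x, forall k : 'I_N.+1,
    x k%:Z = y k%:Z /\ x (- k%:Z) = y (- k%:Z).
  by apply: filter_forall => k; apply: filterI; exact: H.
apply: filterS HN => y /= Hy i iN; have [h1 h2] := Hy (Ordinal (iN : `|i| < N.+1)%N).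
by move: h1 h2 => /=; case: (intP i) => [|n|n]; rewrite ?abszN.
Qed.

(** If no window around x forced membership in U, points outside U agreeing with
x on larger and larger windows would converge to x. *)
Lemma open_coreE (U : set conf) : open U -> U = \bigcup_N core N U.
Proof.
move=> oU; apply/seteqP; split => [x Ux|x [N _ /core_sub//]].
apply: contrapT => H.
have /choice[y Hy] : forall N, exists y, agree N x y /\ ~ U y.
  move=> N; apply: contrapT => HN; apply: H; exists N => // z xz.
  by apply: contrapT => nUz; apply: HN; exists z.
have yx : (y @ \oo) --> (x : conf).
  apply/cvg_sup => i; rewrite cvg_image; last first.
    by rewrite eqEsubset; split=> v // _; exists (fun=> v).
  move=> A /= Ai; exists (proj i @^-1` A); last first.
    by rewrite eqEsubset; split => [b [? + <-//]|b Ab]; exists (fun=> b).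
  exists `|i|%N => // n /= n_ge.
  by rewrite /proj -((Hy n).1 i n_ge); exact: nbhs_singleton Ai.
have /yx[N _ /(_ N (leqnn N)) /= UyN] : nbhs x U by apply: open_nbhs_nbhs.
by case: (Hy N).
Qed.

Lemma windowed_open N C : windowed N C -> open C.
Proof.
move=> wC; rewrite openE => x Cx; rewrite /interior /=.
by apply: filterS (agree_nbhs N x) => y xy; exact: wC Cx.
Qed.

Lemma windowed_continuous (R : realType) N C : windowed N C ->
  continuous (\1_C : conf -> R).
Proof.
move=> wC x A /= /nbhs_singleton Ax.
apply: filterS (agree_nbhs N x) => y xy /=.
have -> // : \1_C y = \1_C x :> R.
rewrite !indicE; congr (nat_of_bool _)%:R.
apply/idP/idP => /set_mem h; apply/mem_set; last exact: wC h.
by apply: wC h; exact: agree_sym.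
Qed.

Lemma sigma_windowed N C (k : int) : windowed N C ->
  windowed (N + `|k|)%N (sigma k @^-1` C).
Proof.
move=> wC x y xy; apply: wC => i iN; rewrite /sigma; apply: xy.
by move: iN; lia.
Qed.

Lemma orbit_closureP (x y : conf) :
  orbit_closure x y <-> forall N, exists k, agree N y (sigma k x).
Proof.
split=> [H N|H A /= Ay].
  have [_ [[k _ <-] yk]] := H _ (agree_nbhs N y).
  by exists k.
have /open_coreE E : open (interior A) by exact: open_interior.
have : interior A y by exact: Ay.
rewrite E => -[N _ yN]; have [k yk] := H N.
exists (sigma k x); split; first by exists k.
by apply: interior_subset; exact: yN.
Qed.

Lemma orbit_closure_closed x : closed (orbit_closure x).
Proof. exact: closed_closure. Qed.

Lemma open_measurable_conf (U : set conf) : open U -> measurable (U : set bconf).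
Proof. by move=> oU; exact: sub_sigma_algebra. Qed.

Lemma closed_measurable_conf (U : set conf) : closed U -> measurable (U : set bconf).
Proof.
move=> cU; rewrite -(setCK U); apply: measurableC; apply: open_measurable_conf.
exact: closed_openC.
Qed.

Lemma windowed_measurable N C : windowed N C -> measurable (C : set bconf).
Proof. by move=> /windowed_open; exact: open_measurable_conf. Qed.

(** Sets depending on finitely many coordinates are a pi-system that generates the
Borel sets, because every open set is the countable union of its cores. *)
Lemma measurable_windowed :
  measurable = <<s [set C : set bconf | exists N, windowed N C] >>.
Proof.
apply/seteqP; split; last first.
  apply: smallest_sub; first exact: sigma_algebra_measurable.
  by move=> C [N /windowed_measurable].
apply: (@smallest_sub _ (sigma_algebra setT) (@open conf)).
  exact: smallest_sigma_algebra.
move=> U /open_coreE ->; apply: sigma_algebra_bigcup => N.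
by apply: sub_sigma_algebra; exists N; exact: core_windowed.
Qed.

Lemma measurable_sigma k : measurable_fun setT (sigma k : bconf -> bconf).
Proof.
apply: (@measurability _ _ bconf bconf setT (sigma k) (@open conf)) => //.
move=> _ [U oU <-].
rewrite setTI (open_coreE oU) preimage_bigcup; apply: bigcupT_measurable => N.
by apply: windowed_measurable; apply: sigma_windowed; exact: core_windowed.
Qed.

End Windows.

Section Measures.
Variable R : realType.
Local Open Scope ereal_scope.

Lemma windowed_measure_unique (m1 m2 : {measure set bconf -> \bar R}) :
  m1 setT < +oo ->
  (forall N C, windowed N C -> m1 C = m2 C) ->
  forall A, measurable A -> m1 A = m2 A.
Proof.
move=> m1oo H A mA.
apply: (measure_unique [set C : set bconf | exists N, windowed N C]
  (fun=> setT)) => //.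
- exact: measurable_windowed.
- by move=> C C' [N wC] [N' wC']; exists (maxn N N'); exact: windowedI.
- by move=> _; exists 0%N.
- by rewrite bigcup_const.
- by move=> C [N /H].
Qed.

Lemma empirical_freq (x : conf) (L : nat) (C : set conf) :
  empirical R x L C = (freq R [set k | C (sigma k x)] L)%:E.
Proof.
have -> : empirical R x L C = (L%:R^-1)%:E *
  \sum_(l < L) \d_(sigma l.+1%:Z x : bconf) (C : set bconf) by [].
rewrite muleC /freq EFinM natr_sum big_add1 /= big_mkord -sumEFin.
by congr (_ * _); apply: eq_bigr => l _; rewrite diracE.
Qed.

End Measures.

(** * Mirsky measures *)

Lemma sigma_add (a b : int) (x : conf) : sigma a (sigma b x) = sigma (a + b) x.
Proof. by apply/funext => i; rewrite /sigma addrA. Qed.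

Section Mirsky.
Variable R : realType.

Definition prob_of (mu : probability bconf R) (C : set conf) : R :=
  fine (mu (C : set bconf)).

Lemma prob_ofE (mu : probability bconf R) N C : windowed N C ->
  mu (C : set bconf) = (prob_of mu C)%:E.
Proof.
move=> /windowed_measurable mC; rewrite /prob_of fineK //.
exact: fin_num_measure.
Qed.

Lemma mirsky_freq (B : set nat) (nu : probability bconf R) l N C :
  is_mirsky B nu -> realizes_lower_density R (multiples B) l ->
  windowed N C ->
  freq R [set k | C (sigma k (free_char B))] (l i) @[i --> \oo] -->
    prob_of nu C.
Proof.
move=> hnu hl wC; have mC := windowed_measurable wC.
have := hnu l hl _ (@windowed_continuous R N C wC).
have E (mu : {measure set bconf -> \bar R}) :
    (\int[mu]_x (\1_C x)%:E = mu (C : set bconf))%E.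
  by rewrite (integral_indic mu measurableT mC) setIT.
rewrite (eq_trans (E nu) (prob_ofE nu wC)) => H.
have /fine_cvgP[_] : (freq R [set k | C (sigma k (free_char B))] (l i))%:E
    @[i --> \oo] --> (prob_of nu C)%:E.
  apply: cvg_trans H; apply: near_eq_cvg; apply: nearW => i.
  by rewrite E empirical_freq.
by [].
Qed.

Lemma freq_indic (E : set int) L :
  freq R E L = (\sum_(1 <= k < L.+1) \1_E k%:Z) / L%:R.
Proof. by rewrite /freq natr_sum. Qed.

Lemma freq_succ (E : set int) L :
  `|freq R [set k | E (k + 1)] L - freq R E L| <= L%:R^-1.
Proof.
rewrite !freq_indic -mulrBl normrM [X in _ * X]ger0_norm ?invr_ge0 //.
rewrite -[leRHS]mul1r ler_wpM2r ?invr_ge0 // -sumrB.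
have -> : \sum_(1 <= k < L.+1) (\1_[set k | E (k + 1)] k%:Z - \1_E k%:Z) =
    \sum_(1 <= k < L.+1) (\1_E k.+1%:Z - \1_E k%:Z) :> R.
  by apply: eq_bigr => k _; rewrite -[in RHS]addn1 PoszD.
rewrite (telescope_sumr (fun k : nat => \1_E k%:Z : R)) // !indicE.
by case: (_ \in _); case: (_ \in _); rewrite /= ler_norml; lra.
Qed.

Lemma inv_nat_cvg0 (l : nat -> nat) : l @ \oo --> \oo ->
  ((l i)%:R^-1 : R) @[i --> \oo] --> (0 : R).
Proof.
move=> hl; apply/cvgrPdist_le => e e0.
have [N _ HN] := near_infty_natSinv_lt (PosNum e0).
have : \forall n \near (l @ \oo), (N.+1 <= n)%N by apply: hl; exact: nbhs_infty_ge.
move=> /= H; near=> i; rewrite sub0r normrN ger0_norm ?invr_ge0 //.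
have li : (N.+1 <= l i)%N by near: i; exact: H.
apply: ltW; rewrite -(prednK (leq_trans (ltn0Sn N) li)); apply: HN => /=.
by rewrite -ltnS prednK // (leq_trans _ li).
Unshelve. all: by end_near.
Qed.

(** Frequencies along an orbit change by at most 1/L under the shift, so that the
two sides agree on sets depending on finitely many coordinates. *)
Lemma mirsky_invariant (B : set nat) (nu : probability bconf R) :
  is_mirsky B nu ->
  forall A : set bconf, measurable A -> nu (sigma 1 @^-1` A) = nu A.
Proof.
move=> hnu; have [l hl] := lower_density_realized R (multiples B).
(* the image of nu under the shift, with its structure of measure *)
pose m1 : {measure set bconf -> \bar R} :=
  measure_function_pushforward__canonical__measure_function_Measure nu (measurable_sigma 1).
apply: (@windowed_measure_unique R m1 nu).
  by rewrite -[m1 setT]/(nu setT) probability_setT ltry.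
move=> N C wC; have wC' := @sigma_windowed N C 1 wC.
apply: (eq_trans (prob_ofE nu wC')); apply/esym.
apply: (eq_trans (prob_ofE nu wC)); congr (_%:E).
have h1 := mirsky_freq hnu hl wC'; have h2 := mirsky_freq hnu hl wC.
apply: cvg_unique h2 _ => //.
set E := [set k | C (sigma k (free_char B))].
have -> : E = [set k | E k] by [].
have d0 : (freq R E (l i) - freq R [set k | (sigma 1 @^-1` C)
    (sigma k (free_char B))] (l i)) @[i --> \oo] --> (0 : R).
  apply/norm_cvg0P; apply: (@squeeze_cvgr _ _ _ _ (cst 0) (fun i => (l i)%:R^-1)).
  - apply: nearW => i; rewrite normr_ge0 /= distrC.
    have -> : [set k | (sigma 1 @^-1` C) (sigma k (free_char B))] =
        [set k | E (k + 1)]; last exact: freq_succ.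
    by apply/funext => k; rewrite /E /preimage /= sigma_add addrC.
  - exact: cvg_cst.
  - by apply: inv_nat_cvg0; case: hl.
have := cvgD d0 h1; rewrite add0r; set f := (X in X @ _ --> _).
have -> : f = (fun i => freq R E (l i)).
  by apply/funext => i; rewrite /f !fctE subrK.
by apply.
Qed.

Lemma mirsky_null (B : set nat) (nu : probability bconf R) N C :
  is_mirsky B nu -> windowed N C ->
  (forall k, ~ C (sigma k (free_char B))) -> nu (C : set bconf) = 0%E.
Proof.
move=> hnu wC H; have [l hl] := lower_density_realized R (multiples B).
rewrite (prob_ofE nu wC); congr (_%:E).
have := mirsky_freq hnu hl wC.
rewrite (_ : [set k | _] = set0); last by apply/seteqP; split=> k // /H.
rewrite (_ : (fun i => _) = cst 0); last first.
  apply/funext => i; rewrite freq_indic big1 ?mul0r // => k _.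
  by rewrite indicE in_set0.
by move=> h; apply/esym; apply: cvg_unique h => //; exact: cvg_cst.
Qed.

(** The complement of X is a countable union of sets that depend on finitely many
coordinates and are never visited by the orbit. *)
Lemma mirsky_support (B : set nat) (nu : probability bconf R) (X : set conf) :
  is_mirsky B nu -> closed X -> (forall k, X (sigma k (free_char B))) ->
  nu (X : set bconf) = 1%E.
Proof.
move=> hnu cX HX; have mX := closed_measurable_conf cX.
have oX : open (~` X) by exact: closed_openC.
have nX : nu (~` X : set bconf) = 0%E.
  rewrite (open_coreE oX).
  have mF N : measurable (core N (~` X) : set bconf).
    exact: windowed_measurable (@core_windowed N (~` X)).
  apply/eqP; rewrite eq_le measure_ge0 andbT.
  apply: le_trans (measure_sigma_subadditive nu mF _ (@subset_refl _ _)) _.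
    by apply: bigcupT_measurable.
  rewrite eseries0 // => N _ _; apply: (mirsky_null hnu (@core_windowed N _)).
  by move=> k /core_sub; apply.
have := probability_setC nu mX; rewrite nX => /esym h.
have fX : nu (X : set bconf) \is a fin_num by exact: fin_num_measure.
move: h; rewrite -(fineK fX) -EFinB => -[] h; congr (_%:E).
by apply/eqP; rewrite eq_sym -subr_eq0 h.
Qed.

Lemma mirsky_inv_probs (B B' : set nat) (nu : probability bconf R) :
  is_mirsky B' nu ->
  (forall k, orbit_closure (free_char B) (sigma k (free_char B'))) ->
  inv_probs R (orbit_closure (free_char B)) nu.
Proof.
move=> hnu H; split; last exact: mirsky_invariant hnu.
by apply: mirsky_support hnu _ H; exact: orbit_closure_closed.
Qed.

Definition one_at0 : set conf := [set x | x 0].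

Lemma one_at0_windowed : windowed 0 one_at0.
Proof. by move=> x y xy; rewrite /one_at0 /= xy. Qed.

Lemma mirsky_one_at0 (B : set nat) (nu : probability bconf R) :
  is_mirsky B nu ->
  prob_of nu one_at0 = 1 - lower_density R (multiples B).
Proof.
move=> hnu; have [l hl] := lower_density_realized R (multiples B).
have h := mirsky_freq hnu hl one_at0_windowed.
have [l_oo hf] := hl.
have h' : (1 - freq R (multiples B) (l i)) @[i --> \oo] -->
    1 - lower_density R (multiples B).
  by apply: cvgB => //; exact: cvg_cst.
suff h2 : freq R [set k | one_at0 (sigma k (free_char B))] (l i) @[i --> \oo] -->
    1 - lower_density R (multiples B) by exact: cvg_unique h h2.
apply: cvg_trans h'; apply: near_eq_cvg.
have : \forall n \near (l @ \oo), (1 <= n)%N by apply: l_oo; exact: nbhs_infty_ge.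
move=> /= H; near=> i; have li : (0 < l i)%N by near: i; exact: H.
rewrite !freq_indic.
have lR : (l i)%:R != 0 :> R by rewrite pnatr_eq0 -lt0n.
apply: (mulIf lR); rewrite mulrBl mul1r !mulfVK //.
rewrite -[X in X - _](_ : \sum_(1 <= k < (l i).+1) 1 = _); last first.
  by rewrite big_const_nat subSS subn0 iter_addr addr0.
rewrite -sumrB; apply: eq_bigr => k _; rewrite !indicE.
have -> : (k%:Z \in [set j | one_at0 (sigma j (free_char B))]) =
    (k%:Z \notin multiples B).
  rewrite -free_charE; apply/idP/idP => [/set_mem|hk]; last apply/mem_set;
    by rewrite /one_at0 /= /sigma add0r.
by case: (_ \in _); rewrite /= ?subrr ?subr0.
Unshelve. all: by end_near.
Qed.

End Mirsky.

(** * Nearly periodic configurations *)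

Section Sandwich.
Variable R : realType.

Lemma sum_indic_window (T m : nat) (P : set int) (k : int) : periodic T P ->
  \sum_(0 <= j < T * m) \1_P (k + j%:Z) =
  m%:R * \sum_(0 <= i < T) \1_P i%:Z :> R.
Proof.
move=> pP; elim: m => [|m IH]; first by rewrite muln0 big_geq // mul0r.
rewrite mulnS addnC (big_cat_nat (n := (T * m)%N)) ?leq_addr //= IH.
rewrite -[in RHS]addn1 natrD mulrDl mul1r; congr (_ + _).
rewrite -{1}[(T * m)%N]add0n big_addn addKn -(sum_one_period R (k + (T * m)%N%:Z) pP).
by apply: eq_bigr => j _; rewrite PoszD addrAC addrA.
Qed.

Lemma sum_indic_window_le (T n : nat) (P : set int) (k : int) : (0 < T)%N ->
  periodic T P ->
  \sum_(0 <= j < n) \1_P (k + j%:Z) <=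
  (n %/ T).+1%:R * \sum_(0 <= i < T) \1_P i%:Z :> R.
Proof.
move=> T0 pP; rewrite -(sum_indic_window _ k pP).
have nT : (n <= T * (n %/ T).+1)%N by rewrite mulnC ltnW // ltn_ceil.
rewrite [leRHS](big_cat_nat (n := n)) //= lerDl.
by apply: sumr_ge0 => j _; rewrite indicE ler0n.
Qed.

(** Regular Toeplitz sequences have this property; it says that the closeness
to periodic configurations is uniform over all long windows. *)
Definition nearly_periodic (x : conf) : Prop := forall e : R, 0 < e ->
  exists (T : nat) (c : conf) (P : set int),
    [/\ (0 < T)%N, forall k, c (k + T%:Z) = c k, periodic T P,
        forall k, x k <> c k -> P k &
        \sum_(0 <= i < T) \1_P i%:Z <= e * T%:R].

(** Off the windows that meet the exceptional periodic set P, the orbit of x visits C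
exactly when the orbit of c does. *)
Lemma nearly_periodic_freq (x : conf) N C (e : R) : nearly_periodic x ->
  windowed N C -> 0 < e ->
  exists (T : nat) (rho : R), (0 < T)%N /\
    forall y, orbit_closure x y ->
    `|\sum_(0 <= i < T) \1_C (sigma i%:Z y) - rho| <= e * T%:R.
Proof.
move=> npx wC e0; have e1 : 0 < e / (N.*2.+1)%:R by rewrite divr_gt0 // ltr0n.
have [T [c [P [T0 pc pP xcP sP]]]] := npx _ e1.
exists T, (\sum_(0 <= i < T) \1_C (sigma i%:Z c)); split => // y Hy.
have [k yk] := (orbit_closureP x y).1 Hy (N + T)%N.
have -> : \sum_(0 <= i < T) \1_C (sigma i%:Z y) =
    \sum_(0 <= i < T) \1_C (sigma (k + i%:Z) x) :> R.
  apply: eq_big_nat => i /andP[_ iT]; rewrite !indicE.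
  have ag : agree N (sigma i%:Z y) (sigma (k + i%:Z) x).
    move=> j jN; rewrite /sigma yk ?/sigma; first by rewrite -addrA [i%:Z + k]addrC.
    by move: jN iT; lia.
  congr (nat_of_bool _)%:R; apply/idP/idP => /set_mem h; apply/mem_set.
    exact: wC h.
  by apply: wC h; exact: agree_sym.
have pF : periodic T [set i | C (sigma i c)].
  move=> i; rewrite /= (_ : sigma (i + T%:Z) c = sigma i c) //.
  by apply/funext => j; rewrite /sigma addrA pc.
have -> : \sum_(0 <= i < T) \1_C (sigma i%:Z c) =
    \sum_(0 <= i < T) \1_C (sigma (k + i%:Z) c) :> R.
  by rewrite -[LHS](sum_one_period R k pF).
rewrite -sumrB; apply: le_trans (ler_norm_sum _ _ _) _.
apply: (@le_trans _ _ (\sum_(0 <= i < T) \sum_(0 <= j < N.*2.+1)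
    \1_P (k - N%:Z + j%:Z + i%:Z))).
  apply: ler_sum => i _; set S := \sum_(0 <= j < _) _.
  have S0 : 0 <= S by apply: sumr_ge0 => j _; rewrite indicE ler0n.
  have [ag|] := pselect (agree N (sigma (k + i%:Z) x) (sigma (k + i%:Z) c)).
    rewrite !indicE (_ : (_ \in C) = (sigma (k + i%:Z) c \in C)) ?subrr ?normr0 //.
    apply/idP/idP => /set_mem h; apply/mem_set; first exact: wC h.
    by apply: wC h; exact: agree_sym.
  move/existsNP => [j /not_implyP[jN nxc]].
  apply: (@le_trans _ _ 1).
    by rewrite !indicE; case: (_ \in _); case: (_ \in _);
      rewrite /= ler_norml; lra.
  have Pj : P (k - N%:Z + (absz (j + N%:Z))%:Z + i%:Z).
    have -> : k - N%:Z + (absz (j + N%:Z))%:Z + i%:Z = j + (k + i%:Z).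
      by rewrite gez0_abs; [ring | move: jN; lia].
    exact: xcP.
  rewrite /S (bigD1_seq (absz (j + N%:Z))) ?iota_uniq ?mem_index_iota //=.
    rewrite indicE mem_set // lerDl; apply: sumr_ge0 => j' _.
    by rewrite indicE ler0n.
  by move: jN; lia.
rewrite exchange_big /=.
rewrite (eq_bigr (fun=> \sum_(0 <= i < T) \1_P i%:Z)); last first.
  by move=> j _; exact: sum_one_period.
rewrite big_const_nat subn0 iter_addr addr0 -[leLHS]mulr_natl.
apply: le_trans (ler_wpM2l (ler0n _ _) sP) _.
by rewrite mulrA [_ * (e / _)]mulrC divfK // pnatr_eq0.
Qed.

(** Integrate the number of visits to C during T steps. *)
Lemma inv_probs_estimate (X : set conf) (mu : probability bconf R) N C T (rho e : R) :
  closed X -> inv_probs R X mu -> windowed N C -> (0 < T)%N ->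
  (forall y, X y -> `|\sum_(0 <= i < T) \1_C (sigma i%:Z y) - rho| <= e) ->
  `|T%:R * prob_of mu C - rho| <= e.
Proof.
move=> cX [muX muinv] wC T0 H; have mX := closed_measurable_conf cX.
have mC i : measurable (sigma i @^-1` C : set bconf).
  exact: windowed_measurable (@sigma_windowed N C i wC).
have inv_i (i : nat) : mu (sigma i%:Z @^-1` C : set bconf) = mu (C : set bconf).
  elim: i => [|i IH].
    by congr (mu _); apply/seteqP; split => x /=;
      rewrite (_ : sigma 0 x = x) //; apply/funext => j; rewrite /sigma addr0.
  rewrite -IH -(muinv _ (mC i%:Z)); congr (mu _); apply/funext => x.
  by rewrite /preimage /= sigma_add intS addrC.
have muIX (A : set bconf) : measurable A -> mu (A `&` X) = mu A.
  move=> mA; apply/eqP; rewrite eq_le; apply/andP; split.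
    by apply: le_measure; rewrite ?inE //; apply: measurableI.
  have muCX : mu (~` X : set bconf) = 0%E.
    by have := probability_setC mu mX; rewrite muX subee.
  have mAX : measurable (A `&` X : set bconf) by exact: measurableI.
  have h := measureU2 mu mAX (measurableC mX).
  apply: (@le_trans _ _ (mu (A `&` X `|` ~` X))); last first.
    by apply: le_trans h _; rewrite [X in (_ + X)%E]muCX adde0.
  apply: le_measure; rewrite ?inE //; first by apply: measurableU => //; exact: measurableC.
  by move=> x Ax; have [Xx|nXx] := pselect (X x); [left|right].
pose f (i : nat) (y : bconf) : \bar R := (\1_(sigma i%:Z @^-1` C) y)%:E.
have mf i : @measurable_fun _ _ bconf (\bar R) X (f i).
  by apply/measurable_EFinP; apply: measurable_indic; exact: mC.
have f0 i y : (X : set bconf) y -> (0 <= f i y)%E by rewrite lee_fin indicE ler0n.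
have I1 : (\int[mu]_(y in X) (\sum_(i <- index_iota 0 T) f i y) =
    (T%:R * prob_of mu C)%:E)%E.
  rewrite (ge0_integral_sum mu mX mf f0).
  rewrite (eq_bigr (fun=> (prob_of mu C)%:E)) => [|i _].
    by rewrite sumEFin big_const_nat subn0 iter_addr addr0 mulr_natl.
  rewrite (integral_indic mu mX (mC i%:Z)).
  apply: eq_trans (muIX _ (mC i%:Z)) _; apply: eq_trans (inv_i i) _.
  exact: prob_ofE wC.
have intc (r : \bar R) : (\int[mu]_(y in X) cst r y = r)%E.
  rewrite (integral_cst mu mX) -[RHS]mule1; congr (_ * _)%E; exact: muX.
have mS : @measurable_fun _ _ bconf (\bar R) X
    (fun y => \sum_(i <- index_iota 0 T) f i y)%E.
  by apply: emeasurable_sum.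
have fE y : (\sum_(i <- index_iota 0 T) f i y =
    (\sum_(0 <= i < T) \1_C (sigma i%:Z y))%:E)%E.
  by rewrite sumEFin.
have p0 : 0 <= T%:R * prob_of mu C.
  by rewrite mulr_ge0 // /prob_of fine_ge0.
rewrite ler_norml; apply/andP; split.
  rewrite lerBrDl; have [h|h] := ltP (rho - e) 0; first by rewrite ltW // (lt_le_trans h).
  have : (\int[mu]_(y in X) cst (rho - e)%:E y <=
      \int[mu]_(y in X) (\sum_(i <- index_iota 0 T) f i y))%E.
    apply: ge0_le_integral => //.
    move=> y Xy; rewrite fE /= lee_fin; have := H y Xy; rewrite ler_norml.
    by case/andP => h1 _; lra.
  by rewrite I1 intc lee_fin.
rewrite lerBlDl.
have : (\int[mu]_(y in X) (\sum_(i <- index_iota 0 T) f i y) <=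
    \int[mu]_(y in X) cst (rho + e)%:E y)%E.
  apply: ge0_le_integral => //.
    by move=> y Xy; apply: sume_ge0 => i _; exact: f0.
  move=> y Xy; rewrite fE /= lee_fin; have := H y Xy; rewrite ler_norml.
  by case/andP => _; lra.
by rewrite I1 intc lee_fin.
Qed.

Lemma nearly_periodic_unique (x : conf) (mu mu' : probability bconf R) :
  nearly_periodic x -> inv_probs R (orbit_closure x) mu ->
  inv_probs R (orbit_closure x) mu' -> same_measure mu mu'.
Proof.
move=> npx hmu hmu'; apply: windowed_measure_unique.
  by rewrite [X in (X < _)%E](probability_setT mu) ltry.
move=> N C wC; apply: (eq_trans (prob_ofE mu wC)).
apply/esym/(eq_trans (prob_ofE mu' wC)); congr (_%:E).
apply/eqP; rewrite -subr_eq0 -normr_le0; apply/ler_addgt0Pr => e e0.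
rewrite add0r; have e2 : 0 < e / 2 by rewrite divr_gt0.
have [T [rho [T0 H]]] := nearly_periodic_freq npx wC e2.
have cX := @orbit_closure_closed x.
have h1 := inv_probs_estimate cX hmu wC T0 H.
have h2 := inv_probs_estimate cX hmu' wC T0 H.
have TR : 0 < T%:R :> R by rewrite ltr0n.
rewrite -(ler_pM2l TR) -[X in X * `|_|]ger0_norm // -normrM.
move: h1 h2; rewrite !ler_norml mulrBr.
move: (prob_of mu C) (prob_of mu' C) => p p' /andP[h1 h2] /andP[h3 h4].
by apply/andP; split; lra.
Qed.
End Sandwich.

(** * Entropy *)

Section Fekete.
Variable R : realType.

(** Fekete: the limit is the infimum of the quotients. *)
Lemma subadditive_cvg (a : nat -> R) : (forall n, 0 <= a n) ->
  (forall m n, a (m + n)%N <= a m + a n) ->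
  cvgn (fun n => a n / n%:R).
Proof.
move=> a0 sub; pose E := [set a n.+1 / n.+1%:R | n in [set: nat]].
have hE : has_inf E.
  split; first by exists (a 1%N / 1), 0%N.
  by exists 0 => _ [n _ <-]; rewrite divr_ge0.
apply/cvg_ex; exists (inf E); apply/cvgrPdist_le => e e0.
have [_ [m _ <-] hm] := inf_adherent (divr_gt0 e0 (ltr0n R 2)) hE.
pose M := \sum_(0 <= r < m.+1) a r.
have M0 : 0 <= M by exact: sumr_ge0.
have am q r : a (q * m.+1 + r)%N <= q%:R * a m.+1 + a r.
  elim: q => [|q IH]; first by rewrite mul0n add0n mul0r add0r.
  rewrite mulSn -addnA; apply: le_trans (sub _ _) _.
  by rewrite -[q.+1%:R]natr1 mulrDl mul1r addrAC [leRHS]addrC lerD2l.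
have hM r : (r < m.+1)%N -> a r <= M.
  move=> rm; rewrite /M (bigD1_seq r) ?iota_uniq ?mem_index_iota //= lerDl.
  exact: sumr_ge0.
have mR : 0 < m.+1%:R :> R by rewrite ltr0n.
near=> n.
have n0 : (0 < n)%N by near: n; exact: nbhs_infty_gt.
have nR : 0 < n%:R :> R by rewrite ltr0n.
have lo : inf E <= a n / n%:R.
  by apply: ge_inf; [case: hE | exists n.-1 => //; rewrite prednK].
have hi : a n <= n%:R * (a m.+1 / m.+1%:R) + M.
  rewrite {1}(divn_eq n m.+1); apply: le_trans (am _ _) _.
  apply: lerD; last by rewrite hM // ltn_mod.
  rewrite mulrCA mulrC ler_wpM2l // ler_pdivlMr // -natrM ler_nat.
  exact: leq_trunc_div.
have Mn : M <= e / 2 * n%:R.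
  rewrite -ler_pdivrMl ?divr_gt0 // mulrC; near: n; exact: nbhs_infty_ger.
have : a n / n%:R <= inf E + e.
  rewrite ler_pdivrMr //; apply: le_trans hi _.
  have : n%:R * (a m.+1 / m.+1%:R) <= n%:R * (inf E + e / 2).
    by rewrite ler_wpM2l // ltW.
  by move: Mn; move: (a m.+1 / m.+1%:R) => b; lra.
by rewrite distrC ler_norml => ?; apply/andP; split; lra.
Unshelve. all: by end_near.
Qed.

End Fekete.

Section Entropy.
Variable R : realType.

Lemma ln2_gt0 : 0 < ln 2 :> R.
Proof. by rewrite ln_gt0 // ltr1n. Qed.

Lemma log2X q : log2 (2 ^+ q) = q%:R :> R.
Proof.
by rewrite /log2 lnXn // -[ln 2 *+ _]mulr_natl mulfK // gt_eqF // ln2_gt0.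
Qed.

Lemma log2M x y : 0 < x -> 0 < y -> log2 (x * y) = log2 x + log2 y :> R.
Proof. by move=> x0 y0; rewrite /log2 lnM ?posrE // mulrDl. Qed.

Lemma log2_le x y : 0 < x -> x <= y -> log2 x <= log2 y :> R.
Proof.
move=> x0 xy; rewrite /log2 ler_pM2r ?invr_gt0 ?ln2_gt0 //.
by rewrite ler_ln ?posrE // (lt_le_trans x0).
Qed.

Lemma complexity_gt0 (X : set conf) x n : X x -> (0 < complexity X n)%N.
Proof.
move=> Xx; apply/card_gt0P; exists [ffun j : 'I_n => x (0 + (j : nat)%:Z)].
rewrite inE; apply/asboolP; exists x; split => //; exists 0 => j.
by rewrite ffunE.
Qed.

Lemma complexityD (X : set conf) m n :
  (complexity X (m + n) <= complexity X m * complexity X n)%N.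
Proof.
rewrite /complexity -cardsX.
pose f (w : {ffun 'I_(m + n) -> bool}) :=
  ([ffun i => w (lshift n i)], [ffun i => w (rshift m i)]).
have finj : injective f.
  move=> w w' [/ffunP h1 /ffunP h2]; apply/ffunP => i.
  case: (splitP i) => j ij.
    have -> : i = lshift n j by apply: val_inj.
    by have := h1 j; rewrite !ffunE.
  have -> : i = rshift m j by apply: val_inj.
  by have := h2 j; rewrite !ffunE.
rewrite -(card_imset _ finj); apply: subset_leq_card.
apply/fintype.subsetP => _ /imsetP[w wD ->]; move: wD.
rewrite !inE => -[x [Xx [i Hi]]].
apply/andP; split; apply/asboolP; exists x; split => //.
  by exists i => j; rewrite ffunE Hi.
by exists (i + m%:Z) => j; rewrite ffunE Hi /= PoszD addrA.
Qed.

Lemma log2_complexity_ge0 (X : set conf) x n : X x ->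
  0 <= log2 (complexity X n)%:R :> R.
Proof.
move=> Xx; rewrite -[X in X <= _](_ : log2 (2 ^+ 0) = _); last exact: log2X.
by rewrite expr0 log2_le // ler1n (complexity_gt0 _ Xx).
Qed.

Lemma entropy_cvg (X : set conf) x : X x ->
  log2 (complexity X n)%:R / n%:R @[n --> \oo] --> entropy R X.
Proof.
move=> Xx; apply: subadditive_cvg => [n|m n]; first exact: log2_complexity_ge0 Xx.
have p k : 0 < (complexity X k)%:R :> R by rewrite ltr0n (complexity_gt0 _ Xx).
by rewrite -log2M // -natrM log2_le // ler_nat complexityD.
Qed.

(** Existence of the entropy as a limit allows one to estimate it along the multiples
of d. *)
Lemma entropy_pos (X : set conf) x (d : nat) (c : R) : X x -> (0 < d)%N ->
  0 < c ->
  (forall n m, m%:R <= c * n%:R -> (2 ^ m <= 2 * complexity X (d * n))%N) ->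
  entropy R X <> 0.
Proof.
move=> Xx d0 c0 H h0; have := entropy_cvg Xx; rewrite h0.
have dR : 0 < d%:R :> R by rewrite ltr0n.
have e0 : 0 < c / (2 * d%:R) by rewrite divr_gt0 // mulr_gt0.
move/cvgrPdist_le => /(_ _ e0)[N _ HN].
(* n > 4 / c makes the loss of 2 from rounding and from the factor 2 harmless *)
pose n := (N + (Num.truncn (4 / c)).+1)%N.
have n0 : (0 < n)%N by rewrite /n addnS.
have nR : 0 < n%:R :> R by rewrite ltr0n.
have n4 : 4 / c < n%:R.
  by apply: lt_le_trans (truncnS_gt _) _; rewrite ler_nat leq_addl.
have Ndn : (N <= d * n)%N.
  by apply: leq_trans (leq_addr _ _) (leq_pmull n d0).
have := HN _ Ndn; rewrite sub0r normrN ger0_norm; last first.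
  by rewrite divr_ge0 // (log2_complexity_ge0 _ Xx).
rewrite natrM ler_pdivrMr ?mulr_gt0 // => h1.
pose m := Num.truncn (c * n%:R).
have cn0 : 0 <= c * n%:R by rewrite mulr_ge0 // ltW.
have mc : m%:R <= c * n%:R by rewrite truncn_le.
have h2 : m%:R - 1 <= log2 (complexity X (d * n))%:R :> R.
  rewrite lerBlDr -[m%:R]log2X -[X in _ + X](_ : log2 (2 ^+ 1) = 1); last exact: log2X.
  rewrite -log2M ?exprn_gt0 //; last by rewrite ltr0n (complexity_gt0 _ Xx).
  rewrite log2_le ?exprn_gt0 // expr1 mulrC -natrX -natrM ler_nat.
  exact: H.
have h3 : c * n%:R < m%:R + 1 by rewrite natr1 truncnS_gt.
have h4 : c / (2 * d%:R) * (d%:R * n%:R) = c * n%:R / 2.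
  by rewrite invfM; field; rewrite gt_eqF.
rewrite h4 in h1; rewrite ltr_pdivrMr // in n4.
by rewrite mulrC in n4; lra.
Qed.

Lemma complexity_free_positions (B : set nat) (d n : nat)
    (W : {set {set 'I_n}}) : (0 < d)%N ->
  (forall w, w \in W -> exists k, w = free_positions B d n k) ->
  (#|W| <= complexity (orbit_closure (free_char B)) (d * n))%N.
Proof.
move=> d0 HW; rewrite /complexity; set A := (X in (_ <= #|X|)%N).
pose f (w : {ffun 'I_(d * n) -> bool}) : {set 'I_n} :=
  [set j : 'I_n | [exists i : 'I_(d * n), (val i == d * j)%N && w i]]%SET.
apply: leq_trans (leq_imset_card f A); apply: subset_leq_card.
apply/fintype.subsetP => w /HW[k ->]; apply/imsetP.
exists [ffun i : 'I_(d * n) => free_char B (k + (i : nat)%:Z)].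
  rewrite inE; apply/asboolP; exists (free_char B); split.
    apply: subset_closure; exists 0 => //.
    by apply/funext => i; rewrite /sigma addr0.
  by exists k => j; rewrite ffunE.
apply/setP => j; rewrite !inE; apply/idP/existsP.
  have dj : (d * j < d * n)%N by rewrite ltn_pmul2l.
  by move=> h; exists (Ordinal dj); rewrite eqxx ffunE /= addrC.
by move=> [i /andP[/eqP ij]]; rewrite ffunE -ij addrC.
Qed.

(** A word of length n is determined by the residue of its position modulo T and by
its values on the exceptional set P, which meets it in at most e (n + T) places. *)
Lemma nearly_periodic_complexity (x : conf) (e : R) : nearly_periodic R x ->
  0 < e ->
  exists2 T : nat, (0 < T)%N & forall n,
    log2 (complexity (orbit_closure x) n)%:R <=
      log2 T%:R + e * (n + T)%N%:R :> R.
Proof.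
move=> npx e0; have [T [c [P [T0 pc pP xcP sP]]]] := npx e e0.
exists T => // n.
have nT0 : 0 <= e * (n + T)%N%:R by rewrite mulr_ge0 // ltW.
pose q := Num.truncn (e * (n + T)%N%:R).
have TR : 0 < T%:R :> R by rewrite ltr0n.
apply: (@le_trans _ _ (log2 T%:R + q%:R)); last by rewrite lerD2l truncn_le.
rewrite -(log2X q) -log2M ?exprn_gt0 // log2_le //.
  rewrite ltr0n; apply: (@complexity_gt0 _ x); apply: subset_closure.
  by exists 0 => //; apply/funext => i; rewrite /sigma addr0.
rewrite -natrX -natrM ler_nat.
have pcz (i m : int) : c (i + T%:Z * m) = c i.
  have h : periodic T [set i | c i] by move=> i'; rewrite /= pc.
  by apply/idP/idP; move/(periodic_mulz i m h).
pose Q (r : 'I_T) := [set j : 'I_n | `[< P ((r : nat)%:Z + (j : nat)%:Z) >]]%SET.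
pose V (r : 'I_T) := [set w : {ffun 'I_n -> bool} |
  [forall j, (j \notin Q r) ==> (w j == c ((r : nat)%:Z + (j : nat)%:Z))]]%SET.
apply: (@leq_trans #|(\bigcup_(r : 'I_T) V r)%SET|).
  apply: subset_leq_card; apply/fintype.subsetP => w; rewrite inE.
  move=> /asboolP[y [Hy [i Hi]]].
  have [k yk] := (orbit_closureP x y).1 Hy (absz i + n)%N.
  have wx j : w j = x (i + k + (j : nat)%:Z).
    rewrite Hi yk /sigma; first by rewrite addrAC.
    by have := ltn_ord j; lia.
  have rT : (absz ((i + k) %% T%:Z)%Z < T)%N.
    by rewrite -ltz_nat gez0_abs ?modz_ge0 ?ltz_pmod // eqz_nat -lt0n.
  apply/finset.bigcupP; exists (Ordinal rT) => //; rewrite inE.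
  have rE : i + k = (absz ((i + k) %% T%:Z)%Z)%:Z + T%:Z * ((i + k) %/ T%:Z)%Z.
    rewrite gez0_abs ?modz_ge0 //; last by rewrite eqz_nat -lt0n.
    by rewrite {1}(divz_eq (i + k) T%:Z) addrC mulrC.
  apply/forallP => j; apply/implyP; rewrite inE /= => /asboolPn nP.
  apply/eqP; rewrite wx; apply: contrapT => nxc; apply: nP.
  apply/(periodic_mulz _ ((i + k) %/ T%:Z)%Z pP); rewrite addrAC -rE.
  apply: xcP; have -> // : c (i + k + (j : nat)%:Z) =
    c ((absz ((i + k) %% T%:Z)%Z)%:Z + (j : nat)%:Z).
  by rewrite [in LHS]rE addrAC pcz.
apply: leq_trans (card_bigcup_le _ _) _.
apply: (@leq_trans (\sum_(r < T) 2 ^ q)); last by rewrite sum_nat_const card_ord.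
apply: leq_sum => r _.
apply: (@leq_trans (2 ^ #|Q r|)).
  rewrite -card_powerset.
  pose f (w : {ffun 'I_n -> bool}) : {set 'I_n} := [set j in Q r | w j]%SET.
  have finj : {in V r &, injective f}.
    move=> w w'; rewrite !inE => /forallP h /forallP h' /setP ff.
    apply/ffunP => j; have := ff j; rewrite !inE.
    case Pj: `[< _ >] => //= _.
    have := h j; have := h' j; rewrite !inE Pj /= => /eqP -> /eqP -> //.
  rewrite -(card_in_imset finj); apply: subset_leq_card.
  apply/fintype.subsetP => _ /imsetP[w _ ->]; rewrite powersetE.
  by apply/fintype.subsetP => j; rewrite inE => /andP[].
rewrite leq_exp2l // truncn_ge_nat //.
have -> : #|Q r|%:R = \sum_(0 <= j < n) \1_P ((r : nat)%:Z + j%:Z) :> R.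
  rewrite -sum1_card natr_sum big_mkcond /= big_mkord; apply: eq_bigr => j _.
  by rewrite inE indicE; case: asboolP => h; [rewrite mem_set | rewrite memNset].
apply: le_trans (sum_indic_window_le R n r T0 pP) _.
apply: le_trans (ler_wpM2l (ler0n _ _) sP) _.
rewrite mulrCA ler_pM2l // -natrM ler_nat mulSn addnC leq_add2r.
exact: leq_trunc_div.
Qed.

Lemma nearly_periodic_entropy0 (x : conf) : nearly_periodic R x ->
  entropy R (orbit_closure x) = 0.
Proof.
move=> npx; rewrite /entropy; apply: cvg_lim => //.
have Xx : orbit_closure x x.
  apply: subset_closure; exists 0 => //.
  by apply/funext => i; rewrite /sigma addr0.
apply/cvgrPdist_le => e e0.
have e2 : 0 < e / 2 by rewrite divr_gt0.
have [T T0 HT] := nearly_periodic_complexity npx e2.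
near=> n.
have n0 : (0 < n)%N by near: n; exact: nbhs_infty_gt.
have nR : 0 < n%:R :> R by rewrite ltr0n.
rewrite sub0r normrN ger0_norm; last first.
  by rewrite divr_ge0 // (log2_complexity_ge0 _ Xx).
rewrite ler_pdivrMr //; apply: le_trans (HT n) _.
have : log2 T%:R + e / 2 * T%:R <= e / 2 * n%:R.
  rewrite -ler_pdivrMl // mulrC; near: n; exact: nbhs_infty_ger.
by rewrite natrD; lra.
Unshelve. all: by end_near.
Qed.

End Entropy.

(** * The Toeplitz sequence of multiples and the theorem *)

Section Regularity.
Variable R : realType.

(** The upper estimate by counting periods, applied to E and to its complement. *)
Lemma freq_periodic_cvg (L : set int -> R) (T : nat) (E : set int) :
  shift_mean L -> (0 < T)%N -> periodic T E ->
  freq R E n @[n --> \oo] --> L E.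
Proof.
move=> sm T0 pE; have TR : 0 < T%:R :> R by rewrite ltr0n.
have up F n : periodic T F ->
    \sum_(1 <= k < n.+1) \1_F k%:Z <= n%:R * L F + T%:R.
  move=> pF; have -> : \sum_(1 <= k < n.+1) \1_F k%:Z =
      \sum_(0 <= j < n) \1_F (1 + j%:Z) :> R.
    by rewrite big_add1; apply: eq_bigr => j _; rewrite -intS.
  apply: le_trans (sum_indic_window_le R n 1 T0 pF) _.
  rewrite -(mean_periodic sm T0 pF) mulrA -natrM mulSn natrD mulrDl addrC.
  apply: lerD; last by rewrite ler_piMr // mean_le1.
  by rewrite ler_wpM2r ?mean_ge0 // ler_nat leq_trunc_div.
apply/cvgrPdist_le => e e0; near=> n.
have n0 : (0 < n)%N by near: n; exact: nbhs_infty_gt.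
have nR : 0 < n%:R :> R by rewrite ltr0n.
have Tn : T%:R <= e * n%:R.
  rewrite -ler_pdivrMl // mulrC; near: n; exact: nbhs_infty_ger.
have h1 := up E n pE; have h2 := up (~` E) n (periodicC pE).
rewrite meanC // in h2.
have E2 : \sum_(1 <= k < n.+1) \1_(~` E) k%:Z =
    n%:R - \sum_(1 <= k < n.+1) \1_E k%:Z :> R.
  rewrite -[n%:R](_ : \sum_(1 <= k < n.+1) 1 = _); last first.
    by rewrite big_const_nat subSS subn0 iter_addr addr0.
  rewrite -sumrB; apply: eq_bigr => k _; rewrite !indicE in_setC.
  by case: (_ \in _); rewrite /= ?subrr ?subr0.
rewrite E2 in h2.
rewrite distrC freq_indic ler_norml; apply/andP; split.
  by rewrite lerBrDr ler_pdivlMr //; lra.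
by rewrite lerBlDr ler_pdivrMr //; lra.
Unshelve. all: by end_near.
Qed.

Lemma density_periodic (L : set int -> R) (T : nat) (E : set int) :
  shift_mean L -> (0 < T)%N -> periodic T E -> density R E = L E.
Proof. by move=> sm T0 pE; apply: cvg_lim => //; exact: freq_periodic_cvg pE. Qed.

Definition periodic_part (x : conf) (r : nat) : set int :=
  \bigcup_(s in [set s | (1 <= s <= r)%N]) Per x s.

Lemma periodic_partP x r k m : periodic_part x r k ->
  x (k + r`!%:Z * m) = x k /\ periodic_part x r (k + r`!%:Z * m).
Proof.
move=> [s /= /andP[s1 sr] ks].
have sf : (s %| r`!)%N by rewrite dvdn_fact // s1.
have E : r`!%:Z * m = s%:Z * ((r`! %/ s)%N%:Z * m).
  by rewrite mulrA -PoszM mulnC divnK.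
split; first by rewrite E; exact: ks.
exists s; first by rewrite /= s1.
by move=> j; rewrite E -addrA -mulrDr !ks.
Qed.

Lemma periodic_part_periodic x r : periodic r`! (periodic_part x r).
Proof.
move=> k; split=> h; last by have := (periodic_partP 1 h).2; rewrite mulr1.
by have := (periodic_partP (-1) h).2; rewrite mulrN1 addrK.
Qed.

Lemma periodic_part_level x r (b : bool) :
  periodic r`! (periodic_part x r `&` [set k | x k = b]).
Proof.
move=> k; split=> -[h xk].
  have := periodic_partP (-1) h; rewrite mulrN1 addrK => -[E h'].
  by split; rewrite //= E.
have := periodic_partP 1 h; rewrite mulr1 => -[E h'].
by split; rewrite //= E.
Qed.

Lemma regular_periodic_part (L : set int -> R) (x : conf) (e : R) :
  shift_mean L -> regular_toeplitz R x -> 0 < e ->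
  exists r, 1 - e <= L (periodic_part x r).
Proof.
move=> sm [_ /cvgrPdist_le H] e0; have [r _ /(_ r (leqnn r)) /=] := H e e0.
rewrite -/(periodic_part x r) (density_periodic sm (fact_gt0 r)); last first.
  exact: periodic_part_periodic.
by rewrite ler_norml => /andP[_ h]; exists r; lra.
Qed.

Section Star.
Variables (B : set nat) (hB : pos_set B).
Variables (L : set int -> R) (hL : sieve_mean L).
Let sm := sieve_shift_mean hL.
Let eta := free_char B.
Let etas := free_char (Bstar B).

Lemma multiples_sub_Bstar : multiples B `<=` multiples (Bstar B).
Proof. by rewrite multiples_Bstar //; left. Qed.

Lemma free_charT A k : (free_char A k = true) = (free_set A k).
Proof.
by apply/propext; rewrite /free_char; split=> [/set_mem|/mem_set].
Qed.

Lemma free_charF A k : (free_char A k = false) = (multiples A k).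
Proof.
apply/propext; rewrite free_charE; split=> [/negbFE/set_mem//|h].
by apply/negbF/mem_set.
Qed.

(** The periodic sets are C, the ones of eta* in the first periods of eta*, and F,
the free set of a finite truncation of B; eta is 1 on C and 0 off F. *)
Lemma mean_Bstar_nearly_periodic : regular_toeplitz R etas ->
  L (multiples (Bstar B)) <= L (multiples B) -> nearly_periodic R eta.
Proof.
move=> reg LM e e0; have e2 : 0 < e / 2 by rewrite divr_gt0.
have [r Hr] := regular_periodic_part sm reg e2.
have [N HN] := sieve_multiples hL hB e2.
set Q := periodic_part etas r in Hr.
pose C := Q `&` [set k | etas k = true].
pose F := free_set (upto N B).
have FB : free_set B `<=` F.
  by move=> k nk nk'; apply: nk; apply: multiples_sub nk' => b [].
have CB : C `<=` free_set B.
  move=> k [_ /=]; rewrite free_charT => nk nk'; apply: nk.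
  exact: multiples_sub_Bstar.
pose T := (r`! * N`!)%N.
have pC : periodic T C by apply: periodic_mul; exact: periodic_part_level.
have pF : periodic T F.
  rewrite /T mulnC; apply: periodic_mul; apply: periodicC.
  exact: multiples_upto_periodic.
have pP : periodic T (F `\` C) by apply: periodicI => //; exact: periodicC.
have T0 : (0 < T)%N by rewrite muln_gt0 !fact_gt0.
exists T, (fun k => k \in C), (F `\` C); split => //.
- by move=> k; apply/idP/idP => /set_mem h; apply/mem_set/pC.
- move=> k neq; have [Ck|nCk] := pselect (C k).
    by case: neq; rewrite (mem_set Ck) free_charT; exact: CB.
  split => //; apply: FB; rewrite -free_charT.
  by move: neq; rewrite memNset // /eta; case: (free_char B k).
rewrite -(mean_periodic sm T0 pP) mulrC ler_wpM2r //.
have h1 := mean_split sm F C.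
rewrite (_ : F `&` C = C) in h1; last first.
  by apply: setIidr => k /CB /FB.
have h2 : L F = 1 - L (multiples (upto N B)) by rewrite /F /free_set meanC.
have h3 : L (free_set (Bstar B)) = 1 - L (multiples (Bstar B)).
  by rewrite /free_set meanC.
have h4 : L (free_set (Bstar B)) <= L C + L (~` Q).
  rewrite (mean_split sm _ Q); apply: lerD; apply: (mean_le sm) => k [] //.
  by move=> fk Qk; split; rewrite //= free_charT.
rewrite meanC // in h4; lra.
Qed.

(** The mean dominates lower densities; the zeros of eta* in its first periods
form a periodic set whose density nearly is the mean of all zeros. *)
Lemma lower_density_mean_Bstar : regular_toeplitz R etas ->
  lower_density R (multiples B) = lower_density R (multiples (Bstar B)) ->
  L (multiples (Bstar B)) <= L (multiples B).
Proof.
move=> reg ld; apply/ler_addgt0Pr => e e0.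
have e2 : 0 < e / 2 by rewrite divr_gt0.
have [r Hr] := regular_periodic_part sm reg e2.
set Q := periodic_part etas r in Hr.
pose C := Q `&` [set k | etas k = false].
have pC : periodic r`! C by exact: periodic_part_level.
have hC := freq_periodic_cvg sm (fact_gt0 r) pC.
have h1 : L C - e / 2 <= lower_density R (multiples (Bstar B)).
  have [N _ HN] := (cvgrPdist_le _ _).1 hC _ e2.
  apply: (@lower_density_ge _ _ _ N) => n nN.
  apply: (@le_trans _ _ (freq R C n)).
    by have := HN n nN; rewrite ler_norml => /andP[_]; lra.
  rewrite !freq_indic ler_wpM2r ?invr_ge0 //; apply: ler_sum => k _.
  rewrite !indicE ler_nat; case: (boolP (k%:Z \in C)) => // /set_mem[_ /=].
  by rewrite free_charF => /mem_set ->.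
have h2 : L (multiples (Bstar B)) <= L C + L (~` Q).
  rewrite (mean_split sm _ Q); apply: lerD; apply: (mean_le sm) => k [] //.
  by move=> fk Qk; split; rewrite //= free_charF.
rewrite meanC // in h2; have h3 := sieve_lower_density hL (multiples B).
by rewrite ld in h3; lra.
Qed.

(** Words of length d n, read at the multiples of d. *)
Lemma mean_free_D_pos d : D_set B d -> 0 < L (free_set B `&` dvdset d) ->
  entropy R (orbit_closure eta) <> 0.
Proof.
move=> Dd b0; set beta := L _ in b0; have [d0 _] := Dd.
have dR : 0 < d%:R :> R by rewrite ltr0n.
have Xx : orbit_closure eta eta.
  apply: subset_closure; exists 0 => //.
  by apply/funext => i; rewrite /sigma addr0.
apply: (entropy_pos (c := d%:R * beta / 2) Xx d0).
  by rewrite divr_gt0 // mulr_gt0.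
move=> n m hm.
pose W := [set w : {set 'I_n} | `[< exists k, w = free_positions B d n k >]]%SET.
apply: leq_trans (_ : 2 * #|W| <= _)%N; last first.
  rewrite leq_mul2l /=; apply: complexity_free_positions => // w.
  by rewrite inE => /asboolP.
apply: disjoint_family_card => S hS.
have [|k hk] := @window_avoiding_many R L hL B d n m S hB Dd.
  apply: le_trans hm _; rewrite -/beta -[leLHS]mulrA.
  apply: ler_wpM2l; first by rewrite mulr_ge0 // ltW.
  have Sn : (#|S| <= n)%N by rewrite -[leqRHS]card_ord max_card.
  have : (2 * #|S|)%:R <= n%:R :> R by rewrite ler_nat.
  by rewrite natrM natrB //; lra.
by exists (free_positions B d n k) => //; rewrite inE; apply/asboolP; exists k.
Qed.

(** A multiple of an element of [Bstar B] that is B-free is a multiple of some d in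
[D_set B]; for each d these have mean zero, and finitely many d suffice up to e. *)
Lemma entropy0_mean_Bstar : entropy R (orbit_closure eta) = 0 ->
  L (multiples (Bstar B)) <= L (multiples B).
Proof.
move=> h0; apply/ler_addgt0Pr => e e0.
have null d : D_set B d -> L (free_set B `&` dvdset d) = 0.
  move=> Dd; apply/eqP; rewrite eq_le mean_ge0 // andbT leNgt; apply/negP => b0.
  exact: mean_free_D_pos Dd b0 h0.
have [N HN] := sieve_multiples hL (pos_Bstar hB) e0.
apply: le_trans HN _; rewrite lerD2r.
pose E d := if `[< D_set B d >] then free_set B `&` dvdset d else set0.
have sub : multiples (upto N (Bstar B)) `<=`
    multiples B `|` \big[setU/set0]_(d <- index_iota 0 N.+1) E d.
  move=> k /multiplesP[b [[Bb _] /= bN] bk].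
  have [Mk|nMk] := pselect (multiples B k); [by left | right].
  rewrite -bigcup_seq; exists b; first by rewrite /= mem_index_iota ltnS bN.
  rewrite /E; case: asboolP => Db; first by split.
  case: Bb => // Bb; case: nMk; apply/multiplesP; by exists b.
apply: le_trans (mean_le sm sub) _; apply: le_trans (meanU sm _ _) _.
rewrite -[leRHS]addr0 lerD2l; apply: le_trans (mean_bigcup sm _ _) _.
rewrite big1 // => d _; rewrite /E; case: asboolP => [/null //|_].
by have := mean_split sm set0 set0; rewrite setI0 set0D => h; lra.
Qed.

End Star.

Lemma orbit_closure_Bstar (B : set nat) k : pos_set B ->
  toeplitz (free_char (Bstar B)) ->
  orbit_closure (free_char B) (sigma k (free_char (Bstar B))).
Proof.
move=> pB tB; apply/orbit_closureP => N.
have [k' Hk'] := @window_Bstar B (N.*2.+1) (k - N%:Z) pB tB.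
exists (k + k') => i iN; rewrite /sigma.
pose z := absz (i + N%:Z).
have zE : z%:Z = i + N%:Z by rewrite /z; move: iN; lia.
have zN : (z < N.*2.+1)%N by rewrite /z; move: iN; lia.
have := Hk' z zN; rewrite zE.
have -> : k - N%:Z + (i + N%:Z) = i + k by ring.
by move=> <-; rewrite addrA.
Qed.

Lemma nearly_periodic_singleton (x : conf) (nu : probability bconf R) :
  nearly_periodic R x -> inv_probs R (orbit_closure x) nu ->
  inv_probs R (orbit_closure x) = msingleton nu.
Proof.
move=> npx hnu; apply/seteqP; split => mu.
  by move=> hmu; exact: nearly_periodic_unique npx hmu hnu.
move=> same; have [nuX nuinv] := hnu.
have mX := closed_measurable_conf (@orbit_closure_closed x).
split; first exact: eq_trans (same _ mX) nuX.
move=> A mA; have mA' : measurable (sigma 1 @^-1` A : set bconf).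
  by rewrite -[X in measurable X]setTI; exact: measurable_sigma.
exact: eq_trans (same _ mA') (eq_trans (nuinv _ mA) (esym (same _ mA))).
Qed.

End Regularity.

Theorem corollaryG (R : realType) (B : set nat) (hB : pos_set B)
    (hreg : regular_toeplitz R (free_char (Bstar B)))
    (nu nustar : probability bconf R)
    (hnu : is_mirsky B nu) (hnustar : is_mirsky (Bstar B) nustar) :
  [/\ entropy R (orbit_closure (free_char B)) = 0 <->
        inv_probs R (orbit_closure (free_char B)) = msingleton nu,
      inv_probs R (orbit_closure (free_char B)) = msingleton nu <->
        uniquely_ergodic R (orbit_closure (free_char B)) &
      uniquely_ergodic R (orbit_closure (free_char B)) -> same_measure nu nustar].
Proof.
have [L hL] := exists_sieve_mean R.
set X := orbit_closure (free_char B).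
have Pnu : inv_probs R X nu.
  apply: mirsky_inv_probs hnu _ => k; apply: subset_closure; by exists k.
have Pnustar : inv_probs R X nustar.
  apply: mirsky_inv_probs hnustar _ => k; apply: orbit_closure_Bstar hB _.
  by case: hreg.
have same_nu : uniquely_ergodic R X -> same_measure nu nustar.
  move=> [mu E] A mA; move: Pnu Pnustar; rewrite E => h h'.
  by rewrite (h A mA) (h' A mA).
have single : nearly_periodic R (free_char B) -> inv_probs R X = msingleton nu.
  by move=> np; exact: nearly_periodic_singleton np Pnu.
have ue_np : uniquely_ergodic R X -> nearly_periodic R (free_char B).
  move=> /same_nu same; apply: (mean_Bstar_nearly_periodic hB hL hreg).
  apply: (lower_density_mean_Bstar hL hreg).
  have : prob_of nu one_at0 = prob_of nustar one_at0.
    by rewrite /prob_of same //; exact: windowed_measurable one_at0_windowed.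
  by rewrite (mirsky_one_at0 hnu) (mirsky_one_at0 hnustar); lra.
have single_ue : inv_probs R X = msingleton nu -> uniquely_ergodic R X.
  by exists nu.
split => //; split.
- move=> h0; apply: single; apply: (mean_Bstar_nearly_periodic hB hL hreg).
  apply: (entropy0_mean_Bstar hB hL); exact: h0.
- by move=> /single_ue /ue_np; exact: nearly_periodic_entropy0.
- exact: single_ue.
- by move=> /ue_np; exact: single.
Qed.
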